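(* Let $\mathfrak g$ be the real Lie algebra $\mathfrak{sl}(2,\mathbb C)$. A subset $U\subseteq\mathcal Q(\mathfrak g)/\mathrm{Aut}_{\mathbb R}(\mathfrak g)$ is open in the quotient topology if and only if the following two properties hold: (1) $U\cap\mathbb D$ is open in the usual topology of the open unit disk $\mathbb D$, where $\mathbb D$ is identified with the subset $\{[\mathrm{II}_\lambda]\}_{\lambda\in\mathbb D}$ of $\mathcal Q(\mathfrak g)/\mathrm{Aut}_{\mathbb R}(\mathfrak g)$ via $\lambda\leftrightarrow[\mathrm{II}_\lambda]$; (2) if $[\mathrm{II}_0]\in U$, then $[\mathrm{III}]\in U$.
   Context: Write elements of $\mathfrak g^{\mathbb C}$ as $X+\hat{\mathrm i}Y$ with $X,Y\in\mathfrak g$, where $\hat{\mathrm i}$ is the formal imaginary unit, and identify $\mathfrak g^{\mathbb C}\cong\mathfrak{sl}(2,\mathbb C)\oplus\mathfrak{sl}(2,\mathbb C)$ via $X+\hat{\mathrm i}Y\mapsto(X+\mathrm iY,\overline{X-\mathrm iY})$ (bar = entrywise conjugation), so that complex conjugation of $\mathfrak g^{\mathbb C}$ is $\sigma(X,Y)=(\overline Y,\overline X)$. Let $\mathcal Q(\mathfrak g)$ be the set of complex $3$-dimensional subspaces $\mathfrak q\subset\mathfrak g^{\mathbb C}$ that are subalgebras and satisfy $\mathfrak q\oplus\sigma\mathfrak q=\mathfrak g^{\mathbb C}$, with the subspace topology from the Grassmannian $\mathrm{Gr}_3(\mathfrak g^{\mathbb C})$ (it is homeomorphic to the space of left-invariant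 complex structures on $\mathrm{SL}(2,\mathbb C)$, a complex structure $J$ corresponding to its $\mathrm i$-eigenspace). The group $\mathrm{Aut}_{\mathbb R}(\mathfrak g)$ of real Lie algebra automorphisms acts on $\mathcal Q(\mathfrak g)$ by $\varphi\cdot\mathfrak q=\varphi(\mathfrak q)$ (with $\varphi$ extended $\mathbb C$-linearly), and $[\mathfrak q]$ denotes the orbit of $\mathfrak q$. With $H=\begin{pmatrix}1&0\\0&-1\end{pmatrix}$, $E=\begin{pmatrix}0&1\\0&0\end{pmatrix}$, $F=\begin{pmatrix}0&0\\1&0\end{pmatrix}$, set $$\mathrm I=\mathfrak{sl}(2,\mathbb C)\oplus0,\quad \mathrm{II}_\lambda=\mathrm{span}_{\mathbb C}\{(H,\lambda H),(E,0),(0,F)\},\quad \mathrm{III}=\mathrm{span}_{\mathbb C}\{(H,0),(E,0),(0,H+F)\}.$$ It is known that $\mathcal Q(\mathfrak g)/\mathrm{Aut}_{\mathbb R}(\mathfrak g)$ is the disjoint union $\{[\mathrm I]\}\sqcup\{[\mathrm{II}_\lambda]\}_{\lambda\in\mathbb D}\sqcup\{[\mathrm{III}]\}$ with the listed classes pairwise distinct, where $\mathbb D=\{\lambda\in\mathbb C:|\lambda|<1\}$. *)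

(* Defs.v *)
From HB Require Import structures.
From mathcomp Require Import all_boot all_order all_algebra.
From mathcomp Require Import all_classical all_reals.
From mathcomp Require Import topology normedtype.
From mathcomp Require Import complex ring zify.

Set Implicit Arguments.
Unset Strict Implicit.
Unset Printing Implicit Defensive.

Import Order.TTheory GRing.Theory Num.Theory numFieldNormedType.Exports.
Import VectorInternalTheory.

Local Open Scope classical_set_scope.
Local Open Scope ring_scope.
Local Open Scope complex_scope.

HB.instance Definition _ (R : realType) := PseudoPointedMetric.copy R[i] R[i]^o.
HB.instance Definition _ (R : realType) := NormedModule.copy R[i] R[i]^o.

Section Grassmannian.
Variables (R : realType) (k : nat) (V : vectType R[i]).

(* A [k]-frame is given by the coordinates of its vectors in the reference
   basis of [V]; the choice of basis does not affect the topology. *)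
Definition frame : Type := [set A : 'M[R[i]]_(k, dim V) | row_free A].
HB.instance Definition _ := Topological.on frame.

Definition frame_vectors (A : frame) : k.-tuple V :=
  [tuple r2v (row i (set_val A)) | i < k].

Lemma dim_span_frame (A : frame) : \dim <<frame_vectors A>> == k.
Proof.
have fA : row_free (set_val A) by exact: set_valP A.
suff /eqP -> : free (frame_vectors A) by rewrite size_tuple.
apply/freeP => c c0 i.
have : (\row_j c j) *m set_val A = 0.
  apply: (can_inj r2vK); rewrite linear0 -[RHS]c0 mulmx_sum_row linear_sum.
  apply: eq_bigr => j _.
  by rewrite linearZ (nth_map j) ?nth_ord_enum ?size_enum_ord ?mxE.
rewrite -[0](mul0mx _ (set_val A)) => /(row_free_inj fA) /rowP /(_ i).
by rewrite !mxE.
Qed.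

Definition grassmannian : Type := {U : {vspace V} | \dim U == k}.
HB.instance Definition _ := Choice.on grassmannian.

Definition span_frame (A : frame) : grassmannian :=
  exist _ <<frame_vectors A>>%VS (dim_span_frame A).

(* The Grassmannian carries the quotient topology from the space of frames. *)
Definition grassmannian_open (U : set grassmannian) := open (span_frame @^-1` U).

Program Definition grassmannian_topology :=
  @isOpenTopological.Build grassmannian grassmannian_open _ _ _.
Next Obligation. by rewrite /grassmannian_open preimage_setT; exact: openT. Qed.
Next Obligation. by move=> ? ? ? ?; exact: openI. Qed.
Next Obligation. by move=> I f ofi; apply: bigcup_open => i _; exact: ofi. Qed.
HB.instance Definition _ := grassmannian_topology.

End Grassmannian.

Section LieAlgebra.
Variable R : realType.
Notation C := R[i].

Definition traceless : {vspace 'M[C]_2} :=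
  lker (linfun (mxtrace : 'M[C]_2 -> C^o)).

Lemma mem_traceless (X : 'M[C]_2) : (X \in traceless) = (\tr X == 0).
Proof. by rewrite memv_ker lfunE. Qed.

Definition sl2 : Type := subvs_of traceless.
HB.instance Definition _ := Vector.on sl2.
HB.instance Definition _ := SubType.on sl2.

Lemma bracket_subproof (X Y : sl2) :
  vsval X *m vsval Y - vsval Y *m vsval X \in traceless.
Proof. by rewrite mem_traceless raddfB /= mxtrace_mulC subrr. Qed.

Definition bracket (X Y : sl2) : sl2 := Subvs (bracket_subproof X Y).

Lemma conj_sl2_subproof (X : sl2) : map_mx conjc (vsval X) \in traceless.
Proof.
have := subvsP X; rewrite !mem_traceless trace_map_mx => /eqP ->.
by rewrite rmorph0.
Qed.

Definition conj_sl2 (X : sl2) : sl2 := Subvs (conj_sl2_subproof X).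

(* [sl2] carries its complex vector space structure; the real one is obtained by
   restricting the scalars to [a%:C] with [a : R]. *)
Definition real_lie_aut (phi : sl2 -> sl2) : Prop :=
  [/\ forall (a : R) X Y, phi (a%:C *: X + Y) = a%:C *: phi X + phi Y,
      {morph phi : X Y / bracket X Y} & bijective phi].

(* The complexification of the real Lie algebra [sl2], in which X + îY is
   identified with [cplx_elt X Y]; [cplx_re] and [cplx_im] recover X and Y. *)
Definition sl2_cplx : Type := (sl2 * sl2)%type.
HB.instance Definition _ := Vector.on sl2_cplx.

Definition cplx_elt (X Y : sl2) : sl2_cplx :=
  (X + 'i *: Y, conj_sl2 (X - 'i *: Y)).

Definition cplx_re (Z : sl2_cplx) : sl2 := 2^-1 *: (Z.1 + conj_sl2 Z.2).
Definition cplx_im (Z : sl2_cplx) : sl2 := (2 * 'i)^-1 *: (Z.1 - conj_sl2 Z.2).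

Definition cplx_bracket (Z W : sl2_cplx) : sl2_cplx :=
  (bracket Z.1 W.1, bracket Z.2 W.2).

Definition cplx_conj (Z : sl2_cplx) : sl2_cplx := (conj_sl2 Z.2, conj_sl2 Z.1).

Lemma conj_sl2D : {morph conj_sl2 : X Y / X + Y}.
Proof. by move=> X Y; apply: val_inj; rewrite /= map_mxD. Qed.

Lemma conj_sl2B : {morph conj_sl2 : X Y / X - Y}.
Proof. by move=> X Y; apply: val_inj; rewrite /= map_mxB. Qed.

Lemma conj_sl2Z (a : C) (X : sl2) : conj_sl2 (a *: X) = a^* *: conj_sl2 X.
Proof. by apply: val_inj; rewrite /= map_mxZ. Qed.

Lemma conj_sl2K : involutive conj_sl2.
Proof.
by move=> X; apply: val_inj; apply/matrixP => i j; rewrite !mxE conjcK.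
Qed.

Lemma sqr_ci : 'i * 'i = -1 :> C.
Proof. by rewrite -expr2 sqr_i. Qed.

Lemma ci_neq0 : 'i != 0 :> C.
Proof. by rewrite eq_complex /= oner_eq0 andbF. Qed.

Lemma half_double (X : sl2) : (2^-1 : C) *: (X + X) = X.
Proof. by rewrite -mulr2n -[X *+ 2]scaler_nat scalerK ?pnatr_eq0. Qed.

Lemma half_ci : 'i * (2 * 'i)^-1 = 2^-1 :> C.
Proof. by rewrite invfM mulrCA mulfV ?ci_neq0 ?mulr1. Qed.

Lemma cplx_eltKre X Y : cplx_re (cplx_elt X Y) = X.
Proof.
by rewrite /cplx_re /= conj_sl2K addrACA subrr addr0 half_double.
Qed.

Lemma cplx_eltKim X Y : cplx_im (cplx_elt X Y) = Y.
Proof.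
rewrite /cplx_im /= conj_sl2K opprB addrC addrA subrK -scalerDr scalerA.
by rewrite mulrC half_ci half_double.
Qed.

Lemma cplx_reimK Z : cplx_elt (cplx_re Z) (cplx_im Z) = Z.
Proof.
case: Z => A B; rewrite /cplx_elt /cplx_re /cplx_im /= scalerA half_ci.
rewrite -scalerDr -scalerBr opprB addrACA subrr addr0 half_double.
rewrite [A + _]addrC addrA [X in X - A]addrAC addrK half_double conj_sl2K.
by [].
Qed.

Lemma bracketDl X Y Z : bracket (X + Y) Z = bracket X Z + bracket Y Z.
Proof. by apply: val_inj; rewrite /= mulmxDl mulmxDr opprD addrACA. Qed.

Lemma bracketDr X Y Z : bracket X (Y + Z) = bracket X Y + bracket X Z.
Proof. by apply: val_inj; rewrite /= mulmxDl mulmxDr opprD addrACA. Qed.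

Lemma bracketZl (a : C) X Y : bracket (a *: X) Y = a *: bracket X Y.
Proof. by apply: val_inj; rewrite /= -scalemxAl -scalemxAr scalerBr. Qed.

Lemma bracketZr (a : C) X Y : bracket X (a *: Y) = a *: bracket X Y.
Proof. by apply: val_inj; rewrite /= -scalemxAl -scalemxAr scalerBr. Qed.

Lemma conj_sl2_bracket X Y :
  conj_sl2 (bracket X Y) = bracket (conj_sl2 X) (conj_sl2 Y).
Proof. by apply: val_inj; rewrite /= map_mxB !map_mxM. Qed.

(* The next three lemmas justify the bracket, conjugation and complex scalar
   multiplication of [sl2_cplx]. *)
Lemma cplx_bracketE X Y X' Y' :
  cplx_bracket (cplx_elt X Y) (cplx_elt X' Y') =
  cplx_elt (bracket X X' - bracket Y Y') (bracket X Y' + bracket Y X').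
Proof.
have H (a : C) (aa : a * a = -1) : bracket (X + a *: Y) (X' + a *: Y') =
  bracket X X' - bracket Y Y' + a *: (bracket X Y' + bracket Y X').
  rewrite bracketDl !bracketDr !bracketZl !bracketZr scalerA aa scaleN1r.
  rewrite scalerDr -!addrA; congr (_ + _).
  by rewrite [_ - bracket Y Y']addrC addrCA.
rewrite /cplx_bracket /cplx_elt /= -conj_sl2_bracket (H _ sqr_ci).
by rewrite -!scaleNr H // mulrNN sqr_ci.
Qed.

Lemma cplx_conjE X Y : cplx_conj (cplx_elt X Y) = cplx_elt X (- Y).
Proof. by rewrite /cplx_conj /cplx_elt /= conj_sl2K scalerN opprK. Qed.

Lemma cplx_scaleiE X Y : 'i *: cplx_elt X Y = cplx_elt (- Y) X.
Proof.
congr (_, _); first by rewrite /= scalerDr scalerA sqr_ci scaleN1r addrC.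
have -> : - Y - 'i *: X = (- 'i) *: (X - 'i *: Y).
  by rewrite scalerBr scalerA mulNr sqr_ci opprK scale1r scaleNr addrC.
rewrite conj_sl2Z; congr (_ *: _); apply/eqP.
by rewrite eq_complex /= oppr0 opprK !eqxx.
Qed.

(* the C-linear extension: phi (X + îY) = phi X + î phi Y *)
Definition cplx_map (phi : sl2 -> sl2) (Z : sl2_cplx) : sl2_cplx :=
  cplx_elt (phi (cplx_re Z)) (phi (cplx_im Z)).

Lemma cplx_conjK : involutive cplx_conj.
Proof. by case=> A B; rewrite /cplx_conj /= !conj_sl2K. Qed.

Lemma cplx_conj_lin (a : C) (Z W : sl2_cplx) :
  cplx_conj (a *: Z + W) = a^* *: cplx_conj Z + cplx_conj W.
Proof. by rewrite /cplx_conj /= !conj_sl2D !conj_sl2Z. Qed.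

(* [cplx_conj] is antilinear, so the image of a subspace is a subspace. *)
Definition cplx_conjv (q : {vspace sl2_cplx}) : {vspace sl2_cplx} :=
  <<map cplx_conj (vbasis q)>>%VS.

Lemma mem_cplx_conjv (q : {vspace sl2_cplx}) (Z : sl2_cplx) :
  (Z \in cplx_conjv q) = (cplx_conj Z \in q).
Proof.
have conj0 : cplx_conj 0 = 0.
  have := cplx_conj_lin (-1) 0 0; rewrite scaler0 addr0 => {1}->.
  by rewrite rmorphN rmorph1 scaleN1r addNr.
have conj_sum n (c : 'I_n -> C) (v : 'I_n -> sl2_cplx) :
    cplx_conj (\sum_i c i *: v i) = \sum_i (c i)^* *: cplx_conj (v i).
  elim: n c v => [|n IH] c v; first by rewrite !big_ord0 conj0.
  by rewrite !big_ord_recl cplx_conj_lin IH.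
apply/idP/idP.
  rewrite /cplx_conjv; have -> : map cplx_conj (vbasis q) = [tuple of map cplx_conj (vbasis q)] by [].
  move=> /coord_span ->; rewrite conj_sum; apply: rpred_sum => i _.
  apply: rpredZ; rewrite (nth_map 0) ?size_tuple // cplx_conjK.
  by apply: vbasis_mem; rewrite mem_nth ?size_tuple.
move=> /coord_vbasis qZ; rewrite -[Z]cplx_conjK {}qZ conj_sum.
apply: rpred_sum => i _; apply: rpredZ; apply: memv_span; apply: map_f.
by rewrite mem_nth ?size_tuple.
Qed.

Lemma cplx_conjvE (q : {vspace sl2_cplx}) :
  [set` cplx_conjv q] = cplx_conj @` [set` q].
Proof.
apply/seteqP; split => [Z|_ [Z qZ <-]] /=; last first.
  by rewrite mem_cplx_conjv cplx_conjK.
by rewrite mem_cplx_conjv => qZ; exists (cplx_conj Z); rewrite ?cplx_conjK.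
Qed.

Definition is_subalgebra (q : {vspace sl2_cplx}) : Prop :=
  forall Z W, Z \in q -> W \in q -> cplx_bracket Z W \in q.

Definition complex_structures : set (grassmannian 3 sl2_cplx) :=
  [set q | let q := \val q in
    [/\ is_subalgebra q, (q :&: cplx_conjv q = 0)%VS &
         (q + cplx_conjv q = fullv)%VS]].

Definition QSpace : Type := complex_structures.
HB.instance Definition _ := Topological.on QSpace.

Definition subspace_of (q : QSpace) : {vspace sl2_cplx} := \val (set_val q).

Definition same_orbit (q q' : QSpace) : bool :=
  `[< exists2 phi, real_lie_aut phi &
        cplx_map phi @` [set` subspace_of q] = [set` subspace_of q'] >].

Lemma same_orbit_refl : reflexive same_orbit.
Proof.
move=> q; apply/asboolP; exists id; first by split => //; exists id.
have -> : cplx_map id = id by apply/funext => Z; exact: cplx_reimK.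
by rewrite image_id.
Qed.

Lemma same_orbit_sym : symmetric same_orbit.
Proof.
suff h q q' : same_orbit q q' -> same_orbit q' q.
  by move=> q q'; apply/idP/idP; exact: h.
move=> /asboolP[phi [lin br [psi phiK psiK]] E]; apply/asboolP; exists psi.
  split; last by exists phi.
  - by move=> a X Y; apply: (can_inj phiK); rewrite lin !psiK.
  - by move=> X Y; apply: (can_inj phiK); rewrite br !psiK.
rewrite -E image_comp; have -> : cplx_map psi \o cplx_map phi = id.
  apply/funext => Z /=.
  by rewrite /cplx_map cplx_eltKre cplx_eltKim !phiK cplx_reimK.
by rewrite image_id.
Qed.

Lemma same_orbit_trans : transitive same_orbit.
Proof.
move=> q' q q'' /asboolP[phi [lin br bij] E] /asboolP[psi [lin' br' bij'] E'].
apply/asboolP; exists (psi \o phi).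
  split; last exact: bij_comp.
  - by move=> a X Y /=; rewrite lin lin'.
  - by move=> X Y /=; rewrite br br'.
rewrite -E' -E image_comp; congr image; apply/funext => Z /=.
by rewrite /cplx_map cplx_eltKre cplx_eltKim.
Qed.

Canonical same_orbit_equiv :=
  EquivRel same_orbit same_orbit_refl same_orbit_sym same_orbit_trans.

Definition orbit_space : Type := quotient_topology {eq_quot same_orbit}%qT.
HB.instance Definition _ := Topological.on orbit_space.
HB.instance Definition _ := Quotient.on orbit_space.

Definition orbit_class (q : QSpace) : orbit_space := (\pi_orbit_space q)%qT.

Lemma orbit_classP (q q' : QSpace) :
  orbit_class q = orbit_class q' <->
  exists2 phi, real_lie_aut phi &
    cplx_map phi @` [set` subspace_of q] = [set` subspace_of q'].
Proof. by split=> [/eqmodP/asboolP|h] //; apply/eqmodP/asboolP. Qed.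

Lemma slH_subproof : delta_mx 0 0 - delta_mx 1 1 \in traceless.
Proof.
by rewrite mem_traceless /mxtrace !big_ord_recl big_ord0 !mxE /= !subr0 sub0r addr0 subrr.
Qed.

Lemma slE_subproof : delta_mx 0 1 \in traceless.
Proof. by rewrite mem_traceless /mxtrace !big_ord_recl big_ord0 !mxE /= !addr0. Qed.

Lemma slF_subproof : delta_mx 1 0 \in traceless.
Proof. by rewrite mem_traceless /mxtrace !big_ord_recl big_ord0 !mxE /= !addr0. Qed.

Definition slH : sl2 := Subvs slH_subproof.
Definition slE : sl2 := Subvs slE_subproof.
Definition slF : sl2 := Subvs slF_subproof.

Lemma bracketNC X Y : bracket X Y = - bracket Y X.
Proof. by apply: val_inj; rewrite /= opprB. Qed.

Lemma bracketXX X : bracket X X = 0.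
Proof. by apply: val_inj; rewrite /= subrr. Qed.

Lemma bracketHE : bracket slH slE = 2 *: slE.
Proof.
apply: val_inj; apply/matrixP => i j; rewrite !mxE !big_ord_recl !big_ord0 !mxE.
by case: i j => [[|[|//]] ?] [[|[|//]] ?] /=; ring.
Qed.

Lemma bracketHF : bracket slH slF = - (2 *: slF).
Proof.
apply: val_inj; apply/matrixP => i j; rewrite !mxE !big_ord_recl !big_ord0 !mxE.
by case: i j => [[|[|//]] ?] [[|[|//]] ?] /=; ring.
Qed.

Lemma conj_slH : conj_sl2 slH = slH.
Proof.
apply: val_inj; apply/matrixP => i j; rewrite !mxE.
by rewrite rmorphB !rmorph_nat.
Qed.

Lemma conj_slE : conj_sl2 slE = slE.
Proof. by apply: val_inj; apply/matrixP => i j; rewrite !mxE rmorph_nat. Qed.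

Lemma conj_slF : conj_sl2 slF = slF.
Proof. by apply: val_inj; apply/matrixP => i j; rewrite !mxE rmorph_nat. Qed.

Lemma sl2_gen (X : sl2) : exists a b c, X = a *: slH + b *: slE + c *: slF.
Proof.
exists (vsval X 0 0), (vsval X 0 1), (vsval X 1 0).
have := subvsP X; rewrite mem_traceless /mxtrace !big_ord_recl big_ord0 addr0 => /eqP tr0.
have {}tr0 : vsval X 1 1 = - vsval X 0 0.
  have e : lift ord0 ord0 = 1 :> 'I_2 by exact: val_inj.
  by apply/eqP; rewrite -addr_eq0 addrC -[X in _ == X]tr0 e.
apply: val_inj; apply/matrixP => i j; rewrite !mxE.
have [e0 e1] : (forall p, @Ordinal 2 0 p = 0) /\ (forall p, @Ordinal 2 1 p = 1).
  by split=> p; exact: val_inj.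
by case: i j => [[|[|//]] p] [[|[|//]] p'] /=; rewrite ?e0 ?e1 ?tr0; ring.
Qed.

Lemma sl2_cplx_gen (q : {vspace sl2_cplx}) :
  (slH, 0) \in q -> (slE, 0) \in q -> (slF, 0) \in q ->
  (0, slH) \in q -> (0, slE) \in q -> (0, slF) \in q -> q = fullv.
Proof.
move=> H1 E1 F1 H2 E2 F2; apply/eqP; rewrite eqEsubv subvf; apply/subvP => -[X Y] _.
have [a [b [c ->]]] := sl2_gen X; have [a' [b' [c' ->]]] := sl2_gen Y.
have -> : (a *: slH + b *: slE + c *: slF, a' *: slH + b' *: slE + c' *: slF) =
  a *: (slH, 0) + b *: (slE, 0) + c *: (slF, 0) +
  (a' *: (0, slH) + b' *: (0, slE) + c' *: (0, slF)) :> sl2_cplx.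
  by congr (_, _); rewrite /= !scaler0 ?addr0 ?add0r.
by rewrite !rpredD ?rpredZ.
Qed.

Lemma cplx_bracket_linl (a : C) Z W T :
  cplx_bracket (a *: Z + W) T = a *: cplx_bracket Z T + cplx_bracket W T.
Proof. by congr (_, _); rewrite /= bracketDl bracketZl. Qed.

Lemma cplx_bracketNC Z W : cplx_bracket Z W = - cplx_bracket W Z.
Proof. by congr (_, _); rewrite /= bracketNC. Qed.

Lemma span_subalgebra (t : seq sl2_cplx) :
  {in t &, forall Z W, cplx_bracket Z W \in <<t>>%VS} -> is_subalgebra <<t>>%VS.
Proof.
move=> h.
have bl n (c : 'I_n -> C) (v : 'I_n -> sl2_cplx) Z :
    cplx_bracket (\sum_i c i *: v i) Z = \sum_i c i *: cplx_bracket (v i) Z.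
  elim: n c v => [|n IH] c v; last by rewrite !big_ord_recl cplx_bracket_linl IH.
  rewrite !big_ord0.
  by congr (_, _); rewrite /= -[0](scale0r 0) bracketZl !scale0r.
have h1 Z W : Z \in <<t>>%VS -> W \in t -> cplx_bracket Z W \in <<t>>%VS.
  move=> /(@coord_span _ _ _ (in_tuple t)) -> tW; rewrite bl.
  by apply: rpred_sum => i _; apply: rpredZ; apply: h => //; rewrite mem_nth.
move=> Z W tZ /(@coord_span _ _ _ (in_tuple t)) ->; rewrite cplx_bracketNC rpredN bl.
apply: rpred_sum => i _; apply: rpredZ; rewrite cplx_bracketNC rpredN.
by apply: h1 => //; rewrite mem_nth.
Qed.

Lemma dim_traceless : (3 <= \dim traceless)%N.
Proof.
have h := limg_ker_dim (linfun (mxtrace : 'M[C]_2 -> C^o)) fullv.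
have h4 : \dim {: 'M[C]_2} = 4 by rewrite dimvf.
have h1 := dimvS (subvf (linfun (mxtrace : 'M[C]_2 -> C^o) @: fullv)%VS).
have h0 : \dim {: C^o} = 1 by rewrite dimvf.
rewrite capfv h4 in h; rewrite h0 in h1.
rewrite -(leq_add2r (\dim (linfun (mxtrace : 'M[C]_2 -> C^o) @: fullv))) h.
by rewrite -[4]/(3 + 1)%N leq_add2l.
Qed.

Lemma dim_sl2_cplx : (6 <= \dim {: sl2_cplx})%N.
Proof.
rewrite dimvf; change (6 <= dim sl2 + dim sl2)%N.
by change (6 <= \dim traceless + \dim traceless)%N; have := dim_traceless; lia.
Qed.

Lemma dim_cplx_conjv (q : {vspace sl2_cplx}) : (\dim (cplx_conjv q) <= \dim q)%N.
Proof. by rewrite (leq_trans (dim_span _)) // size_map size_tuple. Qed.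

Lemma dim_complement_cap (t : 3.-tuple sl2_cplx) :
  (<<t>> + cplx_conjv <<t>>)%VS = fullv ->
  \dim <<t>> = 3%N /\ \dim (<<t>> :&: cplx_conjv <<t>>) = 0%N.
Proof.
have key (a b c d : nat) : (a <= 3 -> b <= a -> c + d = a + b -> 5 < c ->
  a = 3 /\ d = 0)%N by lia.
move=> tf; apply: key (dimv_sum_cap _ _) _; last by rewrite tf dim_sl2_cplx.
- by rewrite (leq_trans (dim_span _)) ?size_tuple.
- exact: dim_cplx_conjv.
Qed.

Lemma dim_complement (t : 3.-tuple sl2_cplx) :
  (<<t>> + cplx_conjv <<t>>)%VS = fullv -> \dim <<t>> == 3%N.
Proof. by case/dim_complement_cap => ->. Qed.

Lemma span_complex_structure (t : 3.-tuple sl2_cplx)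
    (tf : (<<t>> + cplx_conjv <<t>>)%VS = fullv) :
  {in t &, forall Z W, cplx_bracket Z W \in <<t>>%VS} ->
  complex_structures (exist _ <<t>>%VS (dim_complement tf)).
Proof.
move=> talg; split => //=; first exact: span_subalgebra.
by apply/eqP; rewrite -dimv_eq0; have [_ ->] := dim_complement_cap tf.
Qed.

Lemma memv_addl_span (t : seq sl2_cplx) Z :
  Z \in t -> Z \in (<<t>> + cplx_conjv <<t>>)%VS.
Proof.
by move=> tZ; rewrite -[Z]addr0 memv_add ?mem0v ?memv_span.
Qed.

Lemma memv_addr_span (t : seq sl2_cplx) Z :
  Z \in t -> cplx_conj Z \in (<<t>> + cplx_conjv <<t>>)%VS.
Proof.
move=> tZ; rewrite -[cplx_conj Z]add0r memv_add ?mem0v //.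
by rewrite mem_cplx_conjv cplx_conjK memv_span.
Qed.

Definition II_basis (l : C) : 3.-tuple sl2_cplx :=
  [tuple (slH, l *: slH); (slE, 0); (0, slF)].

Definition III_basis : 3.-tuple sl2_cplx :=
  [tuple (slH, 0); (slE, 0); (0, slH + slF)].

(* In [R[i]], [`|l| < 1] compares the modulus of [l] with 1, since the order of
   [R[i]] extends that of [R]. *)
Definition disk : set C := [set l | `|l| < 1].

Lemma disk0_subproof : 0 \in disk.
Proof. by apply: mem_set; rewrite /disk /= normr0 ltr01. Qed.

Definition disk0 : disk := exist (fun l => l \in disk) 0 disk0_subproof.

Lemma conj_sl20 : conj_sl2 0 = 0.
Proof. by rewrite -[0](scale0r 0) conj_sl2Z rmorph0 !scale0r. Qed.

Lemma II_complement (l : disk) :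
  (<<II_basis (set_val l)>> + cplx_conjv <<II_basis (set_val l)>>)%VS = fullv.
Proof.
have : disk (set_val l) by exact: set_valP l.
move: (set_val l) => {}l l1.
have l2 : 1 - l * l^* != 0.
  rewrite subr_eq0 eq_sym -[l * _]normCK; apply/negP => /eqP e.
  by move: l1; rewrite /disk /= -(@ltr_pXn2r _ 2) ?nnegrE ?e ?expr1n ?ltxx.
have hH : slH - (l * l^*) *: slH = (1 - l * l^*) *: slH.
  by rewrite scalerBl scale1r.
have m1 i (i3 : (i < 3)%N) := memv_addl_span (mem_nth (0, 0) (i3 : (i < size (II_basis l))%N)).
have m2 i (i3 : (i < 3)%N) := memv_addr_span (mem_nth (0, 0) (i3 : (i < size (II_basis l))%N)).
have h1 := m1 0 isT; have e1 := m1 1 isT; have f2 := m1 2 isT.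
have h2 := m2 0 isT; have e2 := m2 1 isT; have f1 := m2 2 isT.
rewrite /cplx_conj /= ?conj_sl20 ?conj_sl2Z ?conj_slH ?conj_slE ?conj_slF in h1 h2 e1 e2 f1 f2.
apply: sl2_cplx_gen => //.
- rewrite (_ : (slH, 0) = (1 - l * l^*)^-1 *: ((slH, l *: slH) - l *: (l^* *: slH, slH))).
    by rewrite rpredZ // rpredB // rpredZ.
  congr (_, _); rewrite /= ?subrr ?scaler0 //.
  by rewrite scalerA hH scalerK.
- rewrite (_ : (0, slH) = (1 - l * l^*)^-1 *: ((l^* *: slH, slH) - l^* *: (slH, l *: slH))).
    by rewrite rpredZ // rpredB // rpredZ.
  congr (_, _); rewrite /= ?subrr ?scaler0 //.
  by rewrite scalerA [l^* * l]mulrC hH scalerK.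
Qed.

Lemma III_complement :
  (<<III_basis>> + cplx_conjv <<III_basis>>)%VS = fullv.
Proof.
have m1 i (i3 : (i < 3)%N) := memv_addl_span (mem_nth (0, 0) (i3 : (i < size III_basis)%N)).
have m2 i (i3 : (i < 3)%N) := memv_addr_span (mem_nth (0, 0) (i3 : (i < size III_basis)%N)).
have h1 := m1 0 isT; have e1 := m1 1 isT; have f2 := m1 2 isT.
have h2 := m2 0 isT; have e2 := m2 1 isT; have f1 := m2 2 isT.
rewrite /cplx_conj /= ?conj_sl20 ?conj_sl2D ?conj_slH ?conj_slE ?conj_slF in h1 h2 e1 e2 f1 f2.
apply: sl2_cplx_gen => //.
- rewrite (_ : (slF, 0) = (slH + slF, 0) - (slH, 0)); first by rewrite rpredB.
  by congr (_, _); rewrite /= ?subrr // addrC addKr.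
- rewrite (_ : (0, slF) = (0, slH + slF) - (0, slH)); first by rewrite rpredB.
  by congr (_, _); rewrite /= ?subrr // addrC addKr.
Qed.

Lemma bracketX0 X : bracket X 0 = 0.
Proof. by rewrite -[0](scale0r 0) bracketZr !scale0r. Qed.

Lemma bracket0X X : bracket 0 X = 0.
Proof. by rewrite bracketNC bracketX0 oppr0. Qed.

Lemma three_subalgebra (u v w : sl2_cplx) (q : {vspace sl2_cplx}) :
  cplx_bracket u v \in q -> cplx_bracket u w \in q -> cplx_bracket v w \in q ->
  {in [:: u; v; w] &, forall Z W, cplx_bracket Z W \in q}.
Proof.
move=> uv uw vw Z W.
have b0 T : cplx_bracket T T = 0 by congr (_, _); exact: bracketXX.
rewrite !inE => /or3P[]/eqP-> /or3P[]/eqP->; rewrite ?b0 ?mem0v //;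
  by rewrite cplx_bracketNC rpredN.
Qed.

Lemma II_subalgebra (l : C) :
  {in II_basis l &, forall Z W, cplx_bracket Z W \in <<II_basis l>>%VS}.
Proof.
have m i (i3 : (i < 3)%N) := memv_span (mem_nth (0, 0) (i3 : (i < size (II_basis l))%N)).
have e1 := m 1 isT; have f2 := m 2 isT; rewrite /= in e1 f2.
apply: three_subalgebra.
- rewrite (_ : cplx_bracket _ _ = 2 *: (slE, 0)) ?rpredZ //.
  by congr (_, _); rewrite /= ?bracketX0 ?scaler0 // bracketHE.
- rewrite (_ : cplx_bracket _ _ = (- (l * 2)) *: (0, slF)) ?rpredZ //.
  congr (_, _); rewrite /= ?bracketX0 ?scaler0 // bracketZl bracketHF.
  by rewrite scalerN scalerA scaleNr.
- by rewrite (_ : cplx_bracket _ _ = 0) ?mem0v // /cplx_bracket /= bracketX0 bracket0X.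
Qed.

Lemma III_subalgebra :
  {in III_basis &, forall Z W, cplx_bracket Z W \in <<III_basis>>%VS}.
Proof.
have m i (i3 : (i < 3)%N) := memv_span (mem_nth (0, 0) (i3 : (i < size III_basis)%N)).
have e1 := m 1 isT; rewrite /= in e1.
apply: three_subalgebra.
- rewrite (_ : cplx_bracket _ _ = 2 *: (slE, 0)) ?rpredZ //.
  by congr (_, _); rewrite /= ?bracketX0 ?scaler0 // bracketHE.
- by rewrite (_ : cplx_bracket _ _ = 0) ?mem0v // /cplx_bracket /= bracketX0 bracket0X.
- by rewrite (_ : cplx_bracket _ _ = 0) ?mem0v // /cplx_bracket /= bracketX0 bracket0X.
Qed.

Definition II (l : disk) : QSpace :=
  exist (fun q => q \in complex_structures) _
    (mem_set (span_complex_structure (II_complement l) (@II_subalgebra _))).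

Definition III : QSpace :=
  exist (fun q => q \in complex_structures) _
    (mem_set (span_complex_structure III_complement III_subalgebra)).

Lemma subspace_of_II (l : disk) : subspace_of (II l) = <<II_basis (set_val l)>>%VS.
Proof. by []. Qed.

Lemma subspace_of_III : subspace_of III = <<III_basis>>%VS.
Proof. by []. Qed.

End LieAlgebra.

Arguments complex_structures R _ : clear implicits.
Arguments disk R _ : clear implicits.
Arguments disk0 {R}.
Arguments III {R}.

(* Main.v *)
From HB Require Import structures.
Require Import Defs.
From mathcomp Require Import all_boot all_order all_algebra.
From mathcomp Require Import all_classical all_reals.
From mathcomp Require Import topology normedtype.
From mathcomp Require Import complex ring.

(* Write q for a complex structure, a 3-dimensional subalgebra of sl2 + sl2 meeting
   its conjugate trivially. If q meets one of the two summands trivially, it is the graph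
   of a homomorphism phi on the other one; a nonzero phi would, with psi = conj o phi,
   give an automorphism psi^2 of sl2, which has a nonzero fixed vector X (every
   automorphism has eigenvalue 1), and (X, phi X) would lie in q and its conjugate. So
   phi = 0 and q is of type I. Otherwise q is spanned by some (X, 0), (0, Y) and (A, B),
   and up to conjugation and exchange of the summands by (E, 0), (H, B) and (0, Y), which
   reduces to II or III.

   The types are separated by conditions of the form "there are Z, W in q with
   |f(Z, W)| < |h(Z, W)|", which are open for polynomial f and h. With N1, N2 the trace
   forms of the two summands, N2 = l^2 N1 on II_l, while N1 and N2 are not proportional on
   III and have rank 3 on I (for one of them). Hence the classes of I and III are open, a
   neighbourhood of II_0 meets only III and those II_l with |l| small, and near II_m
   with m <> 0 the parameter l itself, including its sign, is read off the eigenvalues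
   2x and -2xl of ad Z on the components of [Z, W]. Conversely l |-> II_l is continuous,
   and the spans of (H, 0), (E, 0), (0, tH + F), of type III for t <> 0, tend to II_0. *)

Set Implicit Arguments.
Unset Strict Implicit.
Unset Printing Implicit Defensive.

Import Order.TTheory GRing.Theory Num.Theory numFieldNormedType.Exports.
Import VectorInternalTheory.

Local Open Scope classical_set_scope.
Local Open Scope ring_scope.
Local Open Scope complex_scope.

(** * Coordinates, and the action of PSL(2, C) *)

Section Coordinates.
Variable R : realType.
Notation C := R[i].
Notation g := (sl2 R).
Notation gC := (sl2_cplx R).
Implicit Types (X Y : g) (Z W : gC).

(* Locked: unification diverges when it unfolds linear combinations of H, E, F. *)
Definition sl2_mk := locked (fun a b c : C => a *: slH R + b *: slE R + c *: slF R : g).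

Lemma sl2_mkDef a b c : sl2_mk a b c = a *: slH R + b *: slE R + c *: slF R.
Proof. by rewrite /sl2_mk -lock. Qed.
Definition cH X : C := vsval X 0 0.
Definition cE X : C := vsval X 0 1.
Definition cF X : C := vsval X 1 0.

Lemma sl2_mkH a b c : cH (sl2_mk a b c) = a.
Proof. by rewrite sl2_mkDef /cH !mxE /=; ring. Qed.
Lemma sl2_mkE a b c : cE (sl2_mk a b c) = b.
Proof. by rewrite sl2_mkDef /cE !mxE /=; ring. Qed.
Lemma sl2_mkF a b c : cF (sl2_mk a b c) = c.
Proof. by rewrite sl2_mkDef /cF !mxE /=; ring. Qed.

Lemma sl2_mkK X : sl2_mk (cH X) (cE X) (cF X) = X.
Proof.
by have [a [b [c ->]]] := sl2_gen X; rewrite -sl2_mkDef sl2_mkH sl2_mkE sl2_mkF.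
Qed.

Lemma sl2P X Y : cH X = cH Y -> cE X = cE Y -> cF X = cF Y -> X = Y.
Proof. by move=> h e f; rewrite -(sl2_mkK X) h e f sl2_mkK. Qed.

Lemma sl2_coordD X Y :
  ((cH (X + Y) = cH X + cH Y)%R * (cE (X + Y) = cE X + cE Y)%R *
   (cF (X + Y) = cF X + cF Y)%R)%type.
Proof. by rewrite /cH /cE /cF !mxE. Qed.
Lemma sl2_coordZ a X :
  ((cH (a *: X) = a * cH X)%R * (cE (a *: X) = a * cE X)%R *
   (cF (a *: X) = a * cF X)%R)%type.
Proof. by rewrite /cH /cE /cF !mxE. Qed.
Lemma sl2_coordN X : ((cH (- X) = - cH X)%R * (cE (- X) = - cE X)%R *
   (cF (- X) = - cF X)%R)%type.
Proof. by rewrite /cH /cE /cF !mxE. Qed.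
Lemma sl2_coord0 : ((cH 0 = 0)%R * (cE 0 = 0)%R *
   (cF 0 = 0)%R)%type.
Proof. by rewrite /cH /cE /cF !mxE. Qed.
Lemma sl2_coord_conj X :
  ((cH (conj_sl2 X) = conjc (cH X))%R * (cE (conj_sl2 X) = conjc (cE X))%R *
   (cF (conj_sl2 X) = conjc (cF X))%R)%type.
Proof. by rewrite /cH /cE /cF !mxE. Qed.

Lemma ord21 : lift ord0 ord0 = 1 :> 'I_2. Proof. exact: val_inj. Qed.

Lemma sl2_11 X : vsval X 1 1 = - cH X.
Proof.
have := subvsP X; rewrite mem_traceless /mxtrace !big_ord_recl big_ord0 addr0 ord21.
by rewrite addrC addr_eq0 => /eqP.
Qed.

Lemma sl2_coord_bracket X Y :
  ((cH (bracket X Y) = cE X * cF Y - cF X * cE Y)%R *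
   (cE (bracket X Y) = 2 * (cH X * cE Y - cE X * cH Y))%R *
   (cF (bracket X Y) = 2 * (cF X * cH Y - cH X * cF Y))%R)%type.
Proof.
have o0 : ord0 = 0 :> 'I_2 by [].
do ![split]; rewrite /cH /cE /cF !mxE !big_ord_recl !big_ord0 /= ?ord21 ?o0 ?sl2_11 /cH.
- by ring.
- by ring.
- by ring.
Qed.

Definition coordE := (sl2_mkH, sl2_mkE, sl2_mkF, sl2_coordD, sl2_coordZ, sl2_coordN,
  sl2_coord0, sl2_coord_conj, sl2_coord_bracket).

Lemma conjE : ((forall a b : C, conjc (a + b) = conjc a + conjc b)%R *
  (forall a b : C, conjc (a * b) = conjc a * conjc b)%R *
  (forall a : C, conjc (- a) = - conjc a)%R *
  (forall (a : C) n, conjc (a ^+ n) = conjc a ^+ n)%R *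
  (forall n, conjc (n%:R : C) = n%:R)%R *
  (conjc (0 : C) = 0)%R * (conjc (1 : C) = 1)%R)%type.
Proof.
do ![split] => *; first [exact: rmorphD|exact: rmorphM|exact: rmorphN|
  exact: rmorphXn|exact: rmorph_nat|exact: rmorph0|exact: rmorph1].
Qed.

Lemma sl2_stdE : ((slH R = sl2_mk 1 0 0)%R * (slE R = sl2_mk 0 1 0)%R *
  (slF R = sl2_mk 0 0 1)%R)%type.
Proof. by rewrite !sl2_mkDef !scale0r !scale1r !addr0 !add0r. Qed.

(* The trace form tr(XY) in coordinates. *)
Definition form X Y : C := 2 * (cH X * cH Y) + cE X * cF Y + cF X * cE Y.

Lemma form_conj X Y : form (conj_sl2 X) (conj_sl2 Y) = (form X Y)^*.
Proof. by rewrite /form !coordE !conjE. Qed.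

(* Conjugation by the matrix with rows (p, r) and (s, t), when pt - rs = 1. *)
Definition Ad (p r s t : C) X : g :=
  sl2_mk (cH X * (p * t + r * s) + cF X * r * t - cE X * p * s)
    (cE X * p ^+ 2 - 2 * cH X * p * r - cF X * r ^+ 2)
    (2 * cH X * s * t + cF X * t ^+ 2 - cE X * s ^+ 2).

Lemma AdP p r s t a X Y : Ad p r s t (a *: X + Y) = a *: Ad p r s t X + Ad p r s t Y.
Proof. by apply: sl2P; rewrite !coordE; ring. Qed.

Lemma Ad_bracket p r s t X Y : p * t - r * s = 1 ->
  Ad p r s t (bracket X Y) = bracket (Ad p r s t X) (Ad p r s t Y).
Proof.
(* The factor pt - rs makes both sides homogeneous of degree four in the matrix entries, so that
   [ring] proves the identity for arbitrary entries. *)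
move=> d; have -> : Ad p r s t (bracket X Y) = (p * t - r * s) *: Ad p r s t (bracket X Y).
  by rewrite d scale1r.
by apply: sl2P; rewrite !coordE; ring.
Qed.

Lemma form_Ad p r s t X Y : p * t - r * s = 1 ->
  form (Ad p r s t X) (Ad p r s t Y) = form X Y.
Proof.
move=> d; rewrite -[RHS]mul1r -(expr1n _ 2) -d /form !coordE; ring.
Qed.

Lemma AdK p r s t : p * t - r * s = 1 -> cancel (Ad p r s t) (Ad t (- r) (- s) p).
Proof.
move=> d X; rewrite -[RHS]scale1r -(expr1n _ 2) -d.
by apply: sl2P; rewrite !coordE; ring.
Qed.

Lemma Ad_conj p r s t X : conj_sl2 (Ad p r s t X) = Ad p^* r^* s^* t^* (conj_sl2 X).
Proof.
by apply: sl2P; rewrite !coordE !conjE.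
Qed.

Lemma det1_inv p r s t : p * t - r * s = 1 -> t * p - (- r) * (- s) = 1 :> C.
Proof. by move<-; ring. Qed.

Lemma det1_conj p r s t : p * t - r * s = 1 -> p^* * t^* - r^* * s^* = 1 :> C.
Proof.
by move=> d; have := congr1 (@conjc R) d; rewrite !conjE.
Qed.

(* The complex-linear extension of [Ad p r s t] to [gC], see [orb_adV]. *)
Definition adV p r s t Z : gC := (Ad p r s t Z.1, Ad p^* r^* s^* t^* Z.2).
Definition swapV Z : gC := (Z.2, Z.1).

Lemma pairE : ((forall Z W, (Z + W).1 = Z.1 + W.1)%R * (forall Z W, (Z + W).2 = Z.2 + W.2)%R *
  (forall a Z, (a *: Z).1 = a *: Z.1)%R * (forall a Z, (a *: Z).2 = a *: Z.2)%R *
  (forall X Y, ((X, Y) : gC).1 = X)%R * (forall X Y, ((X, Y) : gC).2 = Y)%R)%type.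
Proof. by []. Qed.

Lemma gCP Z W : Z.1 = W.1 -> Z.2 = W.2 -> Z = W.
Proof. by case: Z W => [X Y] [X' Y'] /= -> ->. Qed.

Lemma adVP p r s t a Z W : adV p r s t (a *: Z + W) = a *: adV p r s t Z + adV p r s t W.
Proof. by congr (_, _); exact: AdP. Qed.

Lemma adV_bracket p r s t Z W : p * t - r * s = 1 ->
  adV p r s t (cplx_bracket Z W) = cplx_bracket (adV p r s t Z) (adV p r s t W).
Proof. by move=> d; congr (_, _); apply: Ad_bracket => //; exact: det1_conj. Qed.

Lemma adVK p r s t : p * t - r * s = 1 -> cancel (adV p r s t) (adV t (- r) (- s) p).
Proof.
by move=> d [X Y]; rewrite /adV /= AdK // !rmorphN AdK //; exact: det1_conj.
Qed.

Lemma adV_conj p r s t Z : adV p r s t (cplx_conj Z) = cplx_conj (adV p r s t Z).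
Proof. by congr (_, _); rewrite /= Ad_conj // !conjcK. Qed.

Lemma conj_sl2_scale a X : conj_sl2 (a *: X) = conjc a *: conj_sl2 X.
Proof. exact: conj_sl2Z. Qed.

Lemma conjc_im : conjc 'i = - 'i :> C.
Proof. by apply/eqP; rewrite eq_complex /= oppr0 !eqxx. Qed.

(** The relation of [same_orbit] on bare sets, so that intermediate images need no proof that they
    are complex structures. *)
Definition orb (q q' : set gC) :=
  exists2 phi : g -> g, real_lie_aut phi & cplx_map phi @` q = q'.

Lemma orb_refl q : orb q q.
Proof.
exists id; first by split => //; exists id.
have -> : cplx_map id = @id gC by apply/funext => Z; exact: cplx_reimK.
by rewrite image_id.
Qed.

Lemma orb_trans q q' q'' : orb q q' -> orb q' q'' -> orb q q''.
Proof.
move=> [phi [lin br bij] <-] [psi [lin' br' bij'] <-]; exists (psi \o phi).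
  split; last exact: bij_comp.
  - by move=> a X Y /=; rewrite lin lin'.
  - by move=> X Y /=; rewrite br br'.
rewrite image_comp; congr image; apply/funext => Z /=.
by rewrite /cplx_map cplx_eltKre cplx_eltKim.
Qed.

Lemma orb_sym q q' : orb q q' -> orb q' q.
Proof.
move=> [phi [lin br [psi phiK psiK]] <-]; exists psi.
  split; last by exists phi.
  - by move=> a X Y; apply: (can_inj phiK); rewrite lin !psiK.
  - by move=> X Y; apply: (can_inj phiK); rewrite br !psiK.
rewrite image_comp; have -> : cplx_map psi \o cplx_map phi = id.
  apply/funext => Z /=.
  by rewrite /cplx_map cplx_eltKre cplx_eltKim !phiK cplx_reimK.
by rewrite image_id.
Qed.

(** [Ad p r s t] is complex linear on sl2, so its extension acts by itself on X + iY and by its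
    conjugate on conj (X - iY). *)
Lemma orb_adV p r s t q : p * t - r * s = 1 -> orb q (adV p r s t @` q).
Proof.
move=> d; exists (Ad p r s t).
  split; [by move=> a X Y; rewrite AdP|by move=> X Y; rewrite Ad_bracket|].
  exists (Ad t (- r) (- s) p); first exact: AdK.
  by have := AdK (det1_inv d); rewrite !opprK.
congr image; apply/funext => Z; rewrite -{2}(cplx_reimK Z).
have AdD X Y : Ad p r s t (X + Y) = Ad p r s t X + Ad p r s t Y.
  by have := AdP p r s t 1 X Y; rewrite !scale1r.
have AdZ a X : Ad p r s t (a *: X) = a *: Ad p r s t X.
  by apply: sl2P; rewrite !coordE; ring.
congr (_, _); rewrite /= -?Ad_conj.
  by rewrite AdD (AdZ _ (cplx_im Z)).
by rewrite AdD -(scaleNr _ (cplx_im Z)) (AdZ _ (cplx_im Z)) scaleNr.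
Qed.

(** The automorphism is entrywise conjugation: its extension has first component conj X + i conj Y =
    conj (X - iY), the former second component. *)
Lemma orb_swapV q : orb q (swapV @` q).
Proof.
exists (@conj_sl2 R).
  split; last by exists (@conj_sl2 R); exact: conj_sl2K.
    by move=> a X Y; rewrite conj_sl2D conj_sl2_scale conjc_real.
  by move=> X Y; rewrite conj_sl2_bracket.
congr image; apply/funext => Z; rewrite -{2}(cplx_reimK Z).
rewrite /cplx_map /cplx_elt /swapV /=; move: (cplx_re Z) (cplx_im Z) => X Y.
congr (_, _); first by rewrite conj_sl2B conj_sl2_scale conjc_im scaleNr opprK.
by rewrite conj_sl2B conj_sl2_scale !conj_sl2K conjc_im scaleNr opprK.
Qed.

(** Generated by inner automorphisms and the exchange of the summands. These suffice to reach the
    models, and stability of a condition has to be checked on two generators only, without computing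
    the full automorphism group. *)
Inductive conjq (q : set gC) : set gC -> Prop :=
| conj_refl : conjq q q
| conj_ad q' p r s t : conjq q q' -> p * t - r * s = 1 -> conjq q (adV p r s t @` q')
| conj_swap q' : conjq q q' -> conjq q (swapV @` q').

Lemma conj_trans q q' q'' : conjq q q' -> conjq q' q'' -> conjq q q''.
Proof.
move=> qq'; elim=> // [q1 p r s t _ h d|q1 _ h]; first exact: conj_ad.
exact: conj_swap.
Qed.

Lemma conj_orb q q' : conjq q q' -> orb q q'.
Proof.
elim=> [|q1 p r s t _ h d|q1 _ h]; first exact: orb_refl.
  by apply: orb_trans h _; exact: orb_adV.
by apply: orb_trans h _; exact: orb_swapV.
Qed.

Definition conj_stable (W : set gC -> Prop) :=
  (forall q p r s t, p * t - r * s = 1 -> W q -> W (adV p r s t @` q)) /\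
  (forall q, W q -> W (swapV @` q)).

(** The converse implications hold because the inverse of each generator is again a generator. *)
Lemma conj_stableP (W : set gC -> Prop) q q' : conj_stable W -> conjq q q' -> W q <-> W q'.
Proof.
move=> [Wa Ws]; elim=> // [q1 p r s t _ -> d|q1 _ ->]; split.
- exact: Wa.
- move/(Wa _ _ _ _ _ (det1_inv d)); rewrite image_comp.
  have -> : adV t (- r) (- s) p \o adV p r s t = id by apply/funext; exact: adVK.
  by rewrite image_id.
- exact: Ws.
- move/Ws; rewrite image_comp.
  have -> : swapV \o swapV = id by apply/funext; case.
  by rewrite image_id.
Qed.

End Coordinates.
Arguments swapV {R} _.

Ltac coord := rewrite ?pairE ?sl2_stdE ?coordE.

(** * Classification of the subalgebras *)

Section Models.
Variable R : realType.
Notation C := R[i].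
Notation g := (sl2 R).
Notation gC := (sl2_cplx R).
Implicit Types (X Y A B e h : g) (Z W u v w : gC) (q : set gC).

Definition lin3 u v w : set gC := [set Z | exists x y z, Z = x *: u + y *: v + z *: w].

Definition lin_closed q := forall a Z W, q Z -> q W -> q (a *: Z + W).

(** Complex structures as bare sets; the dimension is a separate hypothesis, see
    [classification]. *)
Definition admissible q :=
  [/\ lin_closed q, q 0, forall Z W, q Z -> q W -> q (cplx_bracket Z W) &
      forall Z, q Z -> q (cplx_conj Z) -> Z = 0].

Lemma lin_closedZ q a Z : lin_closed q -> q 0 -> q Z -> q (a *: Z).
Proof. by move=> lq q0 qZ; rewrite -[a *: Z]addr0; apply: lq. Qed.

Lemma lin3_closed u v w : lin_closed (lin3 u v w).
Proof.
move=> a _ _ [x [y [z ->]]] [x' [y' [z' ->]]].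
exists (a * x + x'), (a * y + y'), (a * z + z').
by rewrite !scalerDl !scalerDr !scalerA addrACA [in X in X + _ = _]addrACA.
Qed.

Lemma lin3_0 u v w : lin3 u v w 0.
Proof. by exists 0, 0, 0; rewrite !scale0r !addr0. Qed.
Lemma lin3_1 u v w : lin3 u v w u.
Proof. by exists 1, 0, 0; rewrite !scale0r scale1r !addr0. Qed.
Lemma lin3_2 u v w : lin3 u v w v.
Proof. by exists 0, 1, 0; rewrite !scale0r scale1r addr0 add0r. Qed.
Lemma lin3_3 u v w : lin3 u v w w.
Proof. by exists 0, 0, 1; rewrite !scale0r scale1r !add0r. Qed.

Lemma lin3_sub u v w q : lin_closed q -> q 0 -> q u -> q v -> q w -> lin3 u v w `<=` q.
Proof.
move=> lq q0 qu qv qw _ [x [y [z ->]]].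
by rewrite -addrA; apply: (lq) => //; apply: (lq) => //; exact: lin_closedZ.
Qed.

Lemma lin3_eq u v w u' v' w' :
  lin3 u v w u' -> lin3 u v w v' -> lin3 u v w w' ->
  lin3 u' v' w' u -> lin3 u' v' w' v -> lin3 u' v' w' w -> lin3 u v w = lin3 u' v' w'.
Proof.
by move=> *; apply/seteqP; split; apply: lin3_sub => //; first [exact: lin3_closed|exact: lin3_0].
Qed.

Lemma image_lin3 (f : gC -> gC) u v w : (forall a Z W, f (a *: Z + W) = a *: f Z + f W) ->
  f @` lin3 u v w = lin3 (f u) (f v) (f w).
Proof.
move=> fl.
have f0 : f 0 = 0 by have := fl (-1) 0 0; rewrite scaler0 addr0 scaleN1r addNr.
have E x y z : f (x *: u + y *: v + z *: w) = x *: f u + y *: f v + z *: f w.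
  by rewrite -addrA fl fl -[z *: w]addr0 fl f0 addr0 addrA.
apply/seteqP; split=> [_ [_ [x [y [z ->]]] <-]|_ [x [y [z ->]]]] /=.
  by exists x, y, z.
by exists (x *: u + y *: v + z *: w) => //; exists x, y, z.
Qed.

Lemma swapVP a Z W : swapV (a *: Z + W) = a *: swapV Z + swapV W.
Proof. by []. Qed.

Lemma admissible_image (f finv : gC -> gC) q :
  (forall a Z W, f (a *: Z + W) = a *: f Z + f W) -> cancel f finv -> cancel finv f ->
  {morph f : Z W / cplx_bracket Z W} -> {morph f : Z / cplx_conj Z} ->
  admissible q -> admissible (f @` q).
Proof.
move=> fl fK finvK fb fc [lq q0 bq cq].
have f0 : f 0 = 0 by have := fl (-1) 0 0; rewrite scaler0 addr0 scaleN1r addNr.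
split.
- by move=> a _ _ [Z qZ <-] [W qW <-]; exists (a *: Z + W) => //; exact: lq.
- by exists 0.
- by move=> _ _ [Z qZ <-] [W qW <-]; exists (cplx_bracket Z W) => //; exact: bq.
- move=> _ [Z qZ <-] [W qW]; rewrite -fc => /(can_inj fK) WZ.
  by rewrite (cq Z) // -WZ.
Qed.

Lemma admissible_adV p r s t q : p * t - r * s = 1 ->
  admissible q -> admissible (adV p r s t @` q).
Proof.
move=> d; apply: admissible_image (adVP _ _ _ _) (adVK d) _ _ _.
- by have := adVK (det1_inv d); rewrite !opprK.
- by move=> Z W; exact: adV_bracket.
- exact: adV_conj.
Qed.

Lemma admissible_swapV q : admissible q -> admissible (swapV @` q).
Proof. by apply: (@admissible_image _ (@swapV R)) => //; case. Qed.

Definition modelI : set gC := [set Z | Z.2 = 0].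
(** Coordinate equations make membership easy to check; [modelIIE] and [modelIIIE] pass to spanning
    vectors. *)
Definition modelII (l : C) : set gC :=
  [set Z | [/\ cF Z.1 = 0, cE Z.2 = 0 & cH Z.2 = l * cH Z.1]].
Definition modelIII : set gC :=
  [set Z | [/\ cF Z.1 = 0, cE Z.2 = 0 & cF Z.2 = cH Z.2]].

Definition has_model q :=
  [\/ conjq q modelI, exists2 l, disk R l & conjq q (modelII l) | conjq q modelIII].

Lemma has_model_conj q q' : conjq q q' -> has_model q' -> has_model q.
Proof.
move=> qq' [h|[l l1 h]|h]; [apply: Or31|apply: Or32; exists l => //|apply: Or33];
  exact: conj_trans h.
Qed.

Lemma has_model_adV p r s t q : p * t - r * s = 1 ->
  has_model (adV p r s t @` q) -> has_model q.
Proof. by move=> d; apply: has_model_conj; apply: conj_ad d; exact: conj_refl. Qed.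

Lemma has_model_swapV q : has_model (swapV @` q) -> has_model q.
Proof. by apply: has_model_conj; apply: conj_swap; exact: conj_refl. Qed.

Lemma modelIIE l : modelII l = lin3 (slE R, 0) (slH R, l *: slH R) (0, slF R).
Proof.
apply/seteqP; split=> [[X Y]|_ [x [y [z ->]]]].
  rewrite /modelII /= => -[fX eY hY].
  exists (cE X), (cH X), (cF Y).
  by apply: gCP; apply: sl2P; rewrite !pairE ?sl2_stdE !coordE ?fX ?eY ?hY; ring.
by split; rewrite !pairE ?sl2_stdE !coordE; ring.
Qed.

Lemma modelIIIE : modelIII = lin3 (slE R, 0) (slH R, 0) (0, slH R + slF R).
Proof.
apply/seteqP; split=> [[X Y]|_ [x [y [z ->]]]].
  rewrite /modelIII /= => -[fX eY hY].
  exists (cE X), (cH X), (cF Y).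
  by apply: gCP; apply: sl2P; rewrite !pairE ?sl2_stdE !coordE ?fX ?eY ?hY; ring.
by split; rewrite !pairE ?sl2_stdE !coordE; ring.
Qed.

End Models.
Arguments modelI {R} _.
Arguments modelIII {R} _.

(** * Reduction to II and III when (e, h) = (E, H) *)

Section NormalForms.
Variable R : realType.
Notation C := R[i].
Notation g := (sl2 R).
Notation gC := (sl2_cplx R).
Implicit Types (X Y A B e h : g) (Z W u v w : gC) (q : set gC).


(** The common shape of II and III, used with [h, e] = 2e; B couples the second summand to h. *)
Definition glued e h B Y := @lin3 R (e, 0) (h, B) (0, Y).

Lemma glued_congr e h B Y e' h' B' Y' : e = e' -> h = h' -> B = B' -> Y = Y' ->
  glued e h B Y = glued e' h' B' Y'.
Proof. by move=> -> -> -> ->. Qed.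

Lemma glued_adV p r s t e h B Y : adV p r s t @` glued e h B Y =
  glued (Ad p r s t e) (Ad p r s t h) (Ad p^* r^* s^* t^* B) (Ad p^* r^* s^* t^* Y).
Proof.
have Ad0 p' r' s' t' : Ad p' r' s' t' (0 : g) = 0 by apply: sl2P; coord; ring.
by rewrite image_lin3 /adV /= ?Ad0 //; exact: adVP.
Qed.

Lemma glued_scale x y z e h B Y : x != 0 -> z != 0 ->
  glued e h B Y = glued (x *: e) (h + y *: e) B (z *: Y).
Proof.
move=> x0 z0; apply: lin3_eq.
- by exists x, 0, 0; apply: gCP; rewrite !pairE ?scaler0 ?scale0r ?addr0.
- by exists y, 1, 0; apply: gCP; rewrite !pairE ?scaler0 ?scale0r ?scale1r ?addr0 ?add0r // addrC.
- by exists 0, 0, z; apply: gCP; rewrite !pairE ?scaler0 ?scale0r ?scale1r ?addr0 ?add0r.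
- by exists x^-1, 0, 0; apply: gCP; rewrite !pairE ?scaler0 ?scale0r ?scalerK ?addr0.
- exists (- (y / x)), 1, 0; apply: gCP;
    rewrite !pairE ?scaler0 ?scale0r ?scale1r ?addr0 ?add0r // scalerA mulNr divfK //.
  by rewrite scaleNr addrC addrK.
- by exists 0, 0, z^-1; apply: gCP; rewrite !pairE ?scaler0 ?scale0r ?scalerK ?addr0 ?add0r.
Qed.

Lemma glued_shift y e h B Y : glued e h B Y = glued e h (B + y *: Y) Y.
Proof.
apply: lin3_eq; [exact: lin3_1| |exact: lin3_3|exact: lin3_1| |exact: lin3_3].
- by exists 0, 1, y; apply: gCP; rewrite !pairE ?scaler0 ?scale0r ?scale1r ?addr0 ?add0r.
- by exists 0, 1, (- y); apply: gCP;
    rewrite !pairE ?scaler0 ?scale0r ?scale1r ?addr0 ?add0r // scaleNr addrK.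
Qed.

Lemma modelII_glued l : modelII l = glued (slE R) (slH R) (l *: slH R) (slF R).
Proof. exact: modelIIE. Qed.

Lemma modelIII_glued : modelIII = glued (slE R) (slH R) 0 (slH R + slF R).
Proof. exact: modelIIIE. Qed.

(** On the second summand diag(1/s, s) acts through its conjugate diag(1/t, t), which fixes H and
    multiplies F by t^2 = a, so aH + F becomes a(H + F). On the first summand E is merely
    rescaled. *)
Lemma glued_conj_III a : a != 0 -> conjq (glued (slE R) (slH R) 0 (a *: slH R + slF R)) modelIII.
Proof.
move=> a0; have [t t0 ta] : exists2 t, t != 0 & t ^+ 2 = a.
  by exists (sqrtC a); rewrite ?sqrtCK // sqrtC_eq0.
pose s := t^*; have s0 : s != 0 by rewrite conjc_eq0.
have ss : conjc s = t by rewrite /s conjcK.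
have d : s^-1 * s - 0 * 0 = 1 by rewrite mulVf // mul0r subr0.
rewrite [X in conjq _ X](_ : _ = adV s^-1 0 0 s @` glued (slE R) (slH R) 0 (a *: slH R + slF R)).
  by apply: conj_ad d; exact: conj_refl.
rewrite glued_adV modelIII_glued; apply/esym.
rewrite [RHS](@glued_scale (s ^- 2) 0 a) ?invr_eq0 ?expf_neq0 //.
have tV : conjc s^-1 = t^-1 by rewrite -ss; exact: fmorphV.
by apply: glued_congr; apply: sl2P; coord; rewrite ?conjE ?tV ?ss -?ta; field.
Qed.

Lemma has_model_III a : a != 0 -> has_model (glued (slE R) (slH R) 0 (a *: slH R + slF R)).
Proof. by move=> a0; apply/Or33/glued_conj_III. Qed.

(** If |l| = 1 and l' is the conjugate of l, the conjugate of (H, lH) is (l'H, H) = l'(H, lH), which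
    stays in the subspace. *)
Lemma modelII_norm (l : C) : admissible (modelII l) -> `|l| != 1.
Proof.
move=> [lq q0 _ cq]; apply/eqP => l1.
have llc : l * conjc l = 1 by rewrite -(expr1n _ 2) -l1 normCK.
have : ((slH R, l *: slH R) : gC) = 0.
  apply: cq; first by split; coord; rewrite ?mulr0 ?mulr1.
  split; coord; rewrite ?conjE ?mulr0 //.
  by rewrite ?mulr1 llc.
move/(congr1 (fun Z : gC => cH Z.1)); coord => /eqP; rewrite oner_eq0 //.
Qed.

(** The exchange carries (H, lH) to a multiple of (H, H/l) but leaves F in the first summand and E
    in the second; the Weyl element puts them back. *)
Lemma swap_modelII (l : C) : l != 0 ->
  adV 0 1 (-1) 0 @` (swapV @` modelII l) = modelII l^-1.
Proof.
move=> l0; rewrite !modelIIE (image_lin3 _ _ _ (@swapVP R)) image_lin3; last exact: adVP.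
rewrite /adV /swapV; apply: lin3_eq.
- exists 0, 0, (-1); apply: gCP; apply: sl2P; coord; rewrite ?conjE; ring.
- by exists 0, (- l^-1), 0; apply: gCP; apply: sl2P; coord; rewrite ?conjE; field.
- exists (-1), 0, 0; apply: gCP; apply: sl2P; coord; rewrite ?conjE; ring.
- exists 0, 0, (-1); apply: gCP; apply: sl2P; coord; rewrite ?conjE; ring.
- by exists 0, (- l), 0; apply: gCP; apply: sl2P; coord; rewrite ?conjE; field.
- exists (-1), 0, 0; apply: gCP; apply: sl2P; coord; rewrite ?conjE; ring.
Qed.

Lemma has_model_II (l : C) : admissible (modelII l) -> has_model (modelII l).
Proof.
move=> /modelII_norm l1; have [ltl1|gel1] := real_ltP (normr_real l) (real1 C).
  by apply: Or32; exists l => //; exact: conj_refl.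
have l1' : 1 < `|l| by rewrite lt_neqAle eq_sym l1.
have l0 : l != 0 by rewrite -normr_gt0 (lt_trans ltr01).
have d : 0 * 0 - 1 * (-1) = 1 :> C by ring.
apply: has_model_swapV; apply: (has_model_adV d); rewrite swap_modelII //.
apply: Or32; exists l^-1; last exact: conj_refl.
by rewrite /disk /= normfV invf_lt1 // (lt_trans ltr01).
Qed.

Lemma form_bracket Y B : form Y (bracket Y B) = 0.
Proof. by rewrite /form; coord; ring. Qed.

Lemma formZr a X Y : form X (a *: Y) = a * form X Y.
Proof. by rewrite /form; coord; ring. Qed.

(** By invariance of the trace form Y is orthogonal to [Y, B], hence to itself. *)
Lemma eigen_isotropic y Y B : y != 0 -> bracket Y B = y *: Y -> form Y Y = 0.
Proof.
move=> y0 YB; have := form_bracket Y B; rewrite YB formZr => /eqP.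
by rewrite mulf_eq0 (negbTE y0) => /eqP.
Qed.

Lemma eigen_F y B : bracket (slF R) B = y *: slF R -> cE B = 0.
Proof.
move/(congr1 (@cH R)); coord; rewrite mulr0 mul0r mul1r sub0r.
by move/eqP; rewrite oppr_eq0 => /eqP.
Qed.

(** An upper unipotent matrix fixes E, moves H by a multiple of E and brings Y, up to scale, to dl H
    + F. If B = 0, this gives III or II_0 according to whether dl vanishes. Otherwise Y is
    isotropic, so dl = 0, and B is diagonal modulo F. *)
Lemma has_model_EH B Y : admissible (glued (slE R) (slH R) B Y) -> Y != 0 ->
  B = 0 \/ (exists2 y, y != 0 & bracket Y B = y *: Y) ->
  has_model (glued (slE R) (slH R) B Y).
Proof.
move=> adm Y0 BY.
have c0 : cF Y != 0.
  apply/eqP => c0; have [lq q0 bq cq] := adm.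
  (* If cF Y = 0, the conjugate of (0, Y) is a combination of (E, 0) and (H, B): the excess conj(cH
     Y) B vanishes, since either B = 0, or Y is isotropic and cH Y = 0. *)
  suff : ((0, Y) : gC) = 0.
    by move/(congr1 (fun Z : gC => Z.2)) => /= Y0'; rewrite Y0' eqxx in Y0.
  apply: cq; first exact: lin3_3.
  have aB : conjc (cH Y) *: B = 0.
    case: BY => [->|[y y0 /(eigen_isotropic y0)]]; first by rewrite scaler0.
    rewrite /form c0 !mulr0 mul0r !addr0 => /eqP.
    by rewrite !mulf_eq0 pnatr_eq0 orbb => /eqP ->; rewrite conjE scale0r.
  exists (conjc (cE Y)), (conjc (cH Y)), 0.
  apply: gCP; first by apply: sl2P; coord; rewrite ?c0 ?conjE; ring.
  by rewrite !pairE aB scaler0 scale0r !addr0 conj_sl20.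
(* With Y scaled to aH + bE + F, the off-diagonal entry rho yields (a + rho)H + (a^2 + b - (a +
   rho)^2)E + F, so a + rho must be a square root dl of a^2 + b. As [adV] conjugates the entries on
   the second summand, r is the conjugate of rho. *)
pose a := cH Y / cF Y; pose b := cE Y / cF Y.
pose dl := sqrtC (a ^+ 2 + b); pose rho := dl - a; pose r := conjc rho.
have rE : conjc r = rho by rewrite /r conjcK.
have d : 1 * 1 - r * 0 = 1 by ring.
have dlE : dl ^+ 2 = a ^+ 2 + b by rewrite sqrtCK.
pose B' := Ad 1 rho 0 1 B; pose Y' := dl *: slH R + slF R.
have YE : Ad 1 rho 0 1 ((cF Y)^-1 *: Y) = Y'.
  rewrite /Y' /rho; apply: sl2P; coord.
  - by rewrite /a; field.
  - transitivity (b + a ^+ 2 - dl ^+ 2); last by rewrite dlE; ring.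
    by rewrite /a /b; field.
  - by field.
have E : adV 1 r 0 1 @` glued (slE R) (slH R) B Y = glued (slE R) (slH R) B' Y'.
  rewrite (@glued_scale 1 0 (cF Y)^-1) ?oner_eq0 ?invr_eq0 // glued_adV.
  rewrite rE !conjE YE [RHS](@glued_scale 1 (- 2 * r) 1) ?oner_eq0 //.
  by apply: glued_congr; rewrite ?scale1r //; apply: sl2P; coord; ring.
apply: (has_model_adV d); rewrite E.
have := admissible_adV d adm; rewrite E => adm'.
case: BY => [B0|[y y0 YB]].
  have -> : B' = 0 by rewrite /B' B0; apply: sl2P; coord; ring.
  case: (eqVneq dl 0) => [dl0|]; last exact: has_model_III.
  rewrite /Y' dl0 scale0r add0r -(scale0r (slH R)) -modelII_glued.
  by apply: Or32; exists 0; [rewrite /disk /= normr0 ltr01|exact: conj_refl].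
have YB' : bracket Y' B' = y *: Y'.
  rewrite -YE -Ad_bracket; last by ring.
  rewrite bracketZl YB; apply: sl2P; coord; ring.
have dl0 : dl = 0.
  have := eigen_isotropic y0 YB'; rewrite /form /Y'; coord => /eqP.
  rewrite !(mulr0, mul0r, addr0, mulr1) !mulf_eq0 pnatr_eq0 /= orbb.
  by move/eqP.
have Y'F : Y' = slF R by rewrite /Y' dl0 scale0r add0r.
have bB : cE B' = 0 by apply: (@eigen_F y); rewrite -Y'F.
move: adm'; rewrite Y'F (@glued_shift (- cF B')).
have -> : B' + - cF B' *: slF R = cH B' *: slH R.
  by move: B' bB {E YB'} => B1 bB; apply: sl2P; coord; rewrite ?bB; ring.
by rewrite -modelII_glued; exact: has_model_II.
Qed.

End NormalForms.

(** * Reduction of (e, h) to (E, H) *)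

Section BorelNormalForm.
Variable R : realType.
Notation C := R[i].
Notation g := (sl2 R).
Notation gC := (sl2_cplx R).
Implicit Types (X Y A B e h : g) (Z W u v w : gC) (q : set gC).

Lemma form_nilpotent e h : bracket h e = 2 *: e -> form e e = 0.
Proof.
rewrite bracketNC => /eqP; rewrite eqr_oppLR -scaleNr => /eqP.
by apply: eigen_isotropic; rewrite oppr_eq0 pnatr_eq0.
Qed.

(** If e has no E-coefficient, nilpotency makes it a multiple of F, and the Weyl element applies.
    Otherwise a lower unipotent matrix kills the H-coefficient, and the F-coefficient then vanishes
    with the determinant. *)
Lemma Ad_nilpotent e : e != 0 -> form e e = 0 ->
  exists p r s t k, [/\ p * t - r * s = 1, k != 0 & Ad p r s t e = k *: slE R].
Proof.
move=> e0 ee.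
have {}ee : cH e ^+ 2 + cE e * cF e = 0.
  have /eqP := ee; rewrite [X in X == _](_ : _ = 2 * (cH e ^+ 2 + cE e * cF e)).
    by rewrite mulf_eq0 pnatr_eq0 /= => /eqP.
  by rewrite /form; ring.
have [b0|b0] := eqVneq (cE e) 0.
  have a0 : cH e = 0 by apply/eqP; move/eqP: ee; rewrite b0 mul0r addr0 sqrf_eq0.
  exists 0, 1, (-1), 0, (- cF e); split; first by ring.
    rewrite oppr_eq0; apply: contra_neq e0 => c0.
    by apply: sl2P; rewrite ?a0 ?b0 ?c0 sl2_coord0.
  by apply: sl2P; coord; rewrite ?a0 ?b0; ring.
exists 1, 0, (cH e / cE e), 1, (cE e); split=> //; first by ring.
apply: sl2P; coord; [by field|by ring|].
transitivity ((cH e ^+ 2 + cE e * cF e) / cE e); first by field.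
by rewrite ee; ring.
Qed.

Lemma Ad_eq0 p r s t X : p * t - r * s = 1 -> Ad p r s t X = 0 -> X = 0.
Proof.
by move=> d X0; rewrite -[X](AdK d) X0; apply: sl2P; coord; ring.
Qed.

(** Once e is moved to kE, the relation [h, e] = 2e forces h to differ from H by a multiple of E,
    which (E, 0) absorbs. *)
Lemma has_model_glued e h B Y : admissible (glued e h B Y) ->
  e != 0 -> bracket h e = 2 *: e -> Y != 0 ->
  B = 0 \/ (exists2 y, y != 0 & bracket Y B = y *: Y) ->
  has_model (glued e h B Y).
Proof.
move=> adm e0 he Y0 BY.
have [p [r [s [t [k [d k0 Ae]]]]]] := Ad_nilpotent e0 (form_nilpotent he).
have dc := det1_conj d.
have := admissible_adV d adm; move=> adm'; apply: (has_model_adV d).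
move: adm'; rewrite glued_adV Ae.
have Ah : bracket (Ad p r s t h) (k *: slE R) = 2 *: (k *: slE R).
  by rewrite -Ae -Ad_bracket // he; apply: sl2P; coord; ring.
have AY0 : Ad p^* r^* s^* t^* Y != 0.
  by apply: contra_neq Y0 => /(Ad_eq0 dc).
have ABY : Ad p^* r^* s^* t^* B = 0 \/ (exists2 y, y != 0 &
    bracket (Ad p^* r^* s^* t^* Y) (Ad p^* r^* s^* t^* B) = y *: Ad p^* r^* s^* t^* Y).
  case: BY => [->|[y y0 YB]]; first by left; apply: sl2P; coord; ring.
  by right; exists y => //; rewrite -Ad_bracket // YB; apply: sl2P; coord; ring.
move: (Ad p r s t h) (Ad _ _ _ _ B) (Ad _ _ _ _ Y) Ah AY0 ABY => h' B' Y' hE Y'0 BY'.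
have h1 : cH h' = 1.
  have := congr1 (@cE R) hE; coord; rewrite !mulr1 !mulr0 subr0 => /mulfI.
  by rewrite pnatr_eq0 => /(_ isT); rewrite -[RHS]mul1r => /(mulIf k0).
have hF : cF h' = 0.
  have := congr1 (@cH R) hE; coord; rewrite !mulr0 sub0r mulr1.
  by move/eqP; rewrite oppr_eq0 mulf_eq0 (negbTE k0) orbF => /eqP.
have -> : h' = slH R + cE h' / k *: (k *: slE R).
  by apply: sl2P; coord; rewrite ?h1 ?hF; field.
rewrite -[Y' in glued _ _ _ Y']scale1r scalerA divfK //.
have := @glued_scale R k (cE h') 1 (slE R) (slH R) B' Y' k0 (oner_neq0 _) => <-.
by move=> adm'; exact: has_model_EH.
Qed.

End BorelNormalForm.

(** * Subalgebras meeting both summands *)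

Section TwoKernels.
Variable R : realType.
Notation C := R[i].
Notation g := (sl2 R).
Notation gC := (sl2_cplx R).
Implicit Types (X Y A B e h : g) (Z W u v w : gC) (q : set gC).

(** In coordinates the bracket is a cross product up to constants, so its vanishing makes the
    coordinate vectors proportional. *)
Lemma bracket_eq0 X A : X != 0 -> bracket X A = 0 -> exists c, A = c *: X.
Proof.
move=> X0 XA.
have /eqP := congr1 (@cH R) XA; have /eqP := congr1 (@cE R) XA; have /eqP := congr1 (@cF R) XA.
coord; rewrite !mulf_eq0 pnatr_eq0 /= !subr_eq0 => /eqP ha /eqP hb /eqP hc.
have [a0|a0] := eqVneq (cH X) 0; last first.
  exists (cH A / cH X); apply: sl2P; coord; apply: (mulfI a0).
  - by field.
  - by rewrite hb; field.
  - by rewrite -ha; field.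
have [b0|b0] := eqVneq (cE X) 0; last first.
  exists (cE A / cE X); apply: sl2P; coord; apply: (mulfI b0).
  - by rewrite -hb; field.
  - by field.
  - by rewrite hc; field.
have [c0|c0] := eqVneq (cF X) 0; last first.
  exists (cF A / cF X); apply: sl2P; coord; apply: (mulfI c0).
  - by rewrite ha; field.
  - by rewrite -hc; field.
  - by field.
by case/eqP: X0; apply: sl2P; rewrite ?a0 ?b0 ?c0 sl2_coord0.
Qed.

(** X and A span a two-dimensional subalgebra, not abelian since commuting elements are
    proportional. Its derived line provides e, and a multiple of X or A acts on that line by 2. *)
Lemma has_model_borel X A Y : admissible (lin3 (X, 0) (A, 0) (0, Y)) ->
  X != 0 -> (forall x, A <> x *: X) -> Y != 0 ->
  has_model (lin3 (X, 0) (A, 0) (0, Y)).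
Proof.
move=> adm X0 AX Y0; have [lq q0 bq cq] := adm.
have [x [y [z XA]]] := bq _ _ (lin3_1 _ _ _) (lin3_2 _ _ _).
have {z}XA : bracket X A = x *: X + y *: A.
  by move/(congr1 fst): XA; rewrite !pairE /= scaler0 addr0.
suff [e [h [e0 he q_eh]]] : exists e h, [/\ e != 0, bracket h e = 2 *: e &
    lin3 (X, 0) (A, 0) (0, Y) = glued e h 0 Y].
  move: adm; rewrite q_eh => adm; apply: has_model_glued => //; by left.
have [y0|y0] := eqVneq y 0.
  have x0 : x != 0.
    apply/eqP => x0; move: XA; rewrite x0 y0 !scale0r addr0 => /(bracket_eq0 X0) [c].
    exact: AX.
  exists X, (- (2 / x) *: A); split=> //.
    rewrite bracketZl bracketNC XA y0 scale0r addr0 scalerN scaleNr opprK scalerA.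
    by rewrite divfK.
  apply: lin3_eq; [exact: lin3_1| |exact: lin3_3|exact: lin3_1| |exact: lin3_3].
    by exists 0, (- (2 / x)), 0; apply: gCP; rewrite !pairE ?scaler0 ?scale0r ?addr0 ?add0r.
  exists 0, (- (x / 2)), 0; apply: gCP; rewrite !pairE ?scaler0 ?scale0r ?addr0 ?add0r //.
  by rewrite scalerA mulrNN mulrA divfK ?pnatr_eq0 // divff // scale1r.
(* Here e = [X, A], and [X, e] = y e. *)
exists (x *: X + y *: A), ((2 / y) *: X); split.
- apply/eqP => E; apply: (AX (- (x / y))); apply/eqP.
  rewrite -(inj_eq (scalerI y0)) scalerA mulrN mulrCA divff // mulr1 scaleNr.
  by rewrite -addr_eq0 addrC E.
- rewrite bracketZl bracketDr !bracketZr bracketXX scaler0 add0r XA scalerA divfK //.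
- apply: lin3_eq; last exact: lin3_3.
  + by exists x, y, 0; apply: gCP; rewrite !pairE ?scaler0 ?scale0r ?addr0 ?add0r.
  + by exists (2 / y), 0, 0; apply: gCP; rewrite !pairE ?scaler0 ?scale0r ?addr0 ?add0r.
  + exact: lin3_3.
  + exists 0, (y / 2), 0; apply: gCP; rewrite !pairE ?scaler0 ?scale0r ?addr0 ?add0r //.
    by rewrite scalerA mulrA divfK ?pnatr_eq0 // divff // scale1r.
  + exists y^-1, (- (x / 2)), 0; apply: gCP; rewrite !pairE ?scaler0 ?scale0r ?addr0 ?add0r //.
    rewrite scalerDr !scalerA mulVf // scale1r mulNr scaleNr.
    have -> : x / 2 * (2 / y) = y^-1 * x by field.
    by rewrite addrAC subrr add0r.
Qed.

(** If B is a multiple of Y, or A of X, the subalgebra splits and [has_model_borel] applies, after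
    an exchange in the second case. Otherwise [X, A] and [Y, B] are nonzero multiples of X and Y,
    and a multiple of (A, B) takes the place of h and its partner in [glued]. *)
Lemma has_model_kernels X Y A B : admissible (lin3 (X, 0) (0, Y) (A, B)) ->
  X != 0 -> Y != 0 -> ~ (exists2 x, A = x *: X & exists y, B = y *: Y) ->
  has_model (lin3 (X, 0) (0, Y) (A, B)).
Proof.
move=> adm X0 Y0 nAB; have [lq q0 bq cq] := adm.
have [[y By]|nB] := pselect (exists y, B = y *: Y).
  have E : lin3 (X, 0) (0, Y) (A, B) = lin3 (X, 0) (A, 0) (0, Y).
    apply: lin3_eq; [exact: lin3_1| |exact: lin3_2|exact: lin3_1|exact: lin3_3|].
      exists 0, (- y), 1; apply: gCP; rewrite !pairE ?scaler0 ?scale0r ?scale1r ?addr0 ?add0r //.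
      by rewrite By scaleNr addNr.
    by exists 0, 1, y; apply: gCP; rewrite !pairE ?scaler0 ?scale0r ?scale1r ?addr0 ?add0r.
  move: adm; rewrite E => adm; apply: has_model_borel => // x Ax.
  by apply: nAB; exists x => //; exists y.
have [[x Ax]|nA] := pselect (exists x, A = x *: X).
  have E : swapV @` lin3 (X, 0) (0, Y) (A, B) = lin3 (Y, 0) (B, 0) (0, X).
    rewrite (image_lin3 _ _ _ (@swapVP R)) /swapV.
    apply: lin3_eq; [exact: lin3_2| |exact: lin3_1|exact: lin3_3|exact: lin3_1|].
      exists (- x), 0, 1; apply: gCP; rewrite !pairE ?scaler0 ?scale0r ?scale1r ?addr0 ?add0r //.
      by rewrite Ax scaleNr addNr.
    exists 0, 1, x; apply: gCP; rewrite !pairE ?scaler0 ?scale0r ?scale1r ?addr0 ?add0r //.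
  apply: has_model_swapV; move: (admissible_swapV adm); rewrite E => adm'.
  by apply: has_model_borel => // y By; apply: nB; exists y.
have [x [z [z' /[dup] XA1 XA2]]] := bq _ _ (lin3_1 _ _ _) (lin3_3 _ _ _).
have [y' [y [w' /[dup] YB1 YB2]]] := bq _ _ (lin3_2 _ _ _) (lin3_3 _ _ _).
move/(congr1 fst): XA1; move/(congr1 snd): XA2; rewrite !pairE /= bracket0X => XA2 XA1.
move/(congr1 fst): YB1; move/(congr1 snd): YB2; rewrite !pairE /= bracket0X => YB2 YB1.
(* [(X, 0), (A, B)] has second component 0, so its coefficient on (A, B) vanishes, B not being a
   multiple of Y; likewise with the summands exchanged. *)
have sol a b c (U V : g) : 0 = a *: 0 + b *: U + c *: V :> g -> ~ (exists d, V = d *: U) -> c = 0.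
  rewrite scaler0 add0r => E nV; apply/eqP/negP => /negP c0; apply: nV.
  exists (- (b / c)); apply: (scalerI c0).
  rewrite scalerA mulrN mulrCA divff // mulr1 scaleNr; apply/eqP.
  by rewrite -addr_eq0 addrC -E.
have z'0 := sol _ _ _ _ _ XA2 nB.
have w'0 : w' = 0 by apply: (sol y y' w' X A _ nA); rewrite (addrC (y *: 0)).
move: XA1 YB2; rewrite z'0 w'0 !scale0r !scaler0 !addr0 add0r => XA YB.
have x0 : x != 0.
  by apply/eqP => x0; apply: nA; apply: bracket_eq0 => //; rewrite XA x0 scale0r.
have y0 : y != 0.
  by apply/eqP => y0; apply: nB; apply: bracket_eq0 => //; rewrite YB y0 scale0r.
have E : lin3 (X, 0) (0, Y) (A, B) = glued X (- (2 / x) *: A) (- (2 / x) *: B) Y.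
  apply: lin3_eq; [exact: lin3_1| |exact: lin3_2|exact: lin3_1|exact: lin3_3|].
    by exists 0, 0, (- (2 / x)); apply: gCP; rewrite !pairE ?scaler0 ?scale0r ?addr0 ?add0r.
  exists 0, (- (x / 2)), 0; apply: gCP; rewrite !pairE ?scaler0 ?scale0r ?addr0 ?add0r //;
  by rewrite scalerA mulrNN mulrA divfK ?pnatr_eq0 // divff // scale1r.
move: adm; rewrite E => adm; apply: has_model_glued => //.
  by rewrite bracketZl bracketNC XA scalerN scaleNr opprK scalerA divfK.
right; exists (- (2 / x) * y); last by rewrite bracketZr YB scalerA.
by rewrite !mulf_neq0 ?oppr_eq0 ?mulf_neq0 ?invr_eq0 ?pnatr_eq0.
Qed.

End TwoKernels.

(** * Endomorphisms of sl2 and their fixed vectors *)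

Lemma det3 (K : comNzRingType) (F : nat -> nat -> K) : \det (\matrix_(i < 3, j < 3) F i j) =
  F 0%N 0%N * (F 1%N 1%N * F 2%N 2%N - F 1%N 2%N * F 2%N 1%N) - F 0%N 1%N * (F 1%N 0%N * F 2%N 2%N - F 1%N 2%N * F 2%N 0%N) +
  F 0%N 2%N * (F 1%N 0%N * F 2%N 1%N - F 1%N 1%N * F 2%N 0%N).
Proof.
rewrite (expand_det_row _ ord0) !big_ord_recl big_ord0 /cofactor.
rewrite !(expand_det_row _ ord0) !big_ord_recl !big_ord0 /cofactor !det_mx11 !mxE.
by rewrite /= /bump /=; ring.
Qed.

Section LieHomomorphisms.
Variable R : realType.
Notation C := R[i].
Notation g := (sl2 R).
Notation gC := (sl2_cplx R).
Implicit Types (X Y A B e h : g) (Z W u v w : gC) (q : set gC).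

Lemma singular3 (h1 h2 h3 e1 e2 e3 k1 k2 k3 : C) :
  h1 * (e2 * k3 - e3 * k2) - h2 * (e1 * k3 - e3 * k1) + h3 * (e1 * k2 - e2 * k1) = 0 ->
  exists x y z, [/\ (x, y, z) != (0, 0, 0), x * h1 + y * e1 + z * k1 = 0,
    x * h2 + y * e2 + z * k2 = 0 & x * h3 + y * e3 + z * k3 = 0].
Proof.
move=> d0.
pose F i j := nth 0 (nth [::] [:: [:: h1; h2; h3]; [:: e1; e2; e3]; [:: k1; k2; k3]] i) j.
have : \det (\matrix_(i < 3, j < 3) F i j) == 0 by rewrite det3 /F /= d0.
move=> /det0P[v v0 /rowP vM].
have o1 : lift ord0 ord0 = 1 :> 'I_3 by exact: val_inj.
have o2 : lift ord0 (lift ord0 ord0) = 2 :> 'I_3 by exact: val_inj.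
exists (v 0 0), (v 0 1), (v 0 2); split.
- apply: contra_neq v0 => -[v00 v01 v02]; apply/rowP => j; rewrite !mxE.
  case: j => [[|[|[|//]]] p].
  + by rewrite -[RHS]v00; congr (v _ _); exact: val_inj.
  + by rewrite -[RHS]v01; congr (v _ _); exact: val_inj.
  + by rewrite -[RHS]v02; congr (v _ _); exact: val_inj.
- by have := vM 0; rewrite !mxE !big_ord_recl big_ord0 !mxE /= o2 o1 addr0 !addrA.
- by have := vM 1; rewrite !mxE !big_ord_recl big_ord0 !mxE /= o2 o1 addr0 !addrA.
- by have := vM 2; rewrite !mxE !big_ord_recl big_ord0 !mxE /= o2 o1 addr0 !addrA.
Qed.

Definition lie_hom (f : g -> g) :=
  (forall a X Y, f (a *: X + Y) = a *: f X + f Y) /\ {morph f : X Y / bracket X Y}.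

Lemma formC X Y : form X Y = form Y X.
Proof. by rewrite /form; ring. Qed.

Lemma form_bracketA X Y A : form X (bracket Y A) = form (bracket X Y) A.
Proof. by rewrite /form; coord; ring. Qed.

(** The vector triple product identity, for the trace form. *)
Lemma bracket_bracket X Y :
  bracket X (bracket X Y) = (2 * form X X) *: Y - (2 * form X Y) *: X.
Proof. by apply: sl2P; rewrite /form; coord; ring. Qed.

Lemma bracket_HE : bracket (slH R) (slE R) = 2 *: slE R.
Proof. exact: bracketHE. Qed.
Lemma bracket_HF : bracket (slH R) (slF R) = (- 2) *: slF R.
Proof. by rewrite bracketHF scaleNr. Qed.
Lemma bracket_EF : bracket (slE R) (slF R) = slH R.
Proof. by apply: sl2P; coord; ring. Qed.

Lemma lie_homE (f : g -> g) X : lie_hom f ->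
  f X = cH X *: f (slH R) + cE X *: f (slE R) + cF X *: f (slF R).
Proof.
move=> [fl _]; have f0 : f 0 = 0 by have := fl (-1) 0 0; rewrite scaler0 addr0 scaleN1r addNr.
by rewrite -{1}(sl2_mkK X) sl2_mkDef -addrA fl fl -[cF X *: slF R]addr0 fl f0 addr0 addrA.
Qed.

Lemma lie_homZ (f : g -> g) a X : lie_hom f -> f (a *: X) = a *: f X.
Proof.
move=> [fl _]; have f0 : f 0 = 0 by have := fl (-1) 0 0; rewrite scaler0 addr0 scaleN1r addNr.
by rewrite -[a *: X]addr0 fl f0 addr0.
Qed.

Lemma lie_hom_triple (f : g -> g) : lie_hom f ->
  [/\ bracket (f (slH R)) (f (slE R)) = 2 *: f (slE R),
      bracket (f (slH R)) (f (slF R)) = (- 2) *: f (slF R) &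
      bracket (f (slE R)) (f (slF R)) = f (slH R)].
Proof.
move=> fh; have [fl fb] := fh; rewrite -!fb bracket_HE bracket_HF bracket_EF.
by split=> //; rewrite lie_homZ.
Qed.

(** The images h, e, k of H, E, F satisfy the same commutation relations, and these determine their
    Gram matrix. *)
Lemma lie_hom_form (f : g -> g) : lie_hom f -> f (slH R) != 0 ->
  forall X, form (f X) (f X) = form X X.
Proof.
move=> fh fH0 X; have [he hk ek] := lie_hom_triple fh; rewrite (lie_homE X fh).
move: fH0 he hk ek; move: (f (slH R)) (f (slE R)) (f (slF R)) => h e k h0 he hk ek.
have two0 : 2 != 0 :> C by rewrite pnatr_eq0.
have e0 : e != 0 by apply: contra_neq h0 => e0; rewrite -ek e0 bracket0X.
have fhe : form h e = 0.
  by have := form_bracket h e; rewrite he formZr => /eqP; rewrite mulf_eq0 (negbTE two0) => /eqP.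
have fhk : form h k = 0.
  have := form_bracket h k; rewrite hk formZr => /eqP.
  by rewrite mulf_eq0 oppr_eq0 (negbTE two0) => /eqP.
have fee : form e e = 0 by exact: form_nilpotent he.
have fkk : form k k = 0.
  apply: (@eigen_isotropic _ 2 k h) => //.
  by rewrite bracketNC hk scaleNr opprK.
have fhh : form h h = 2.
  (* Comparing [h, [h, e]] = 4e with the triple product formula gives 2 form h h = 4. *)
  have := bracket_bracket h e; rewrite fhe mulr0 scale0r subr0 he bracketZr he scalerA.
  move=> /eqP; rewrite -subr_eq0 -scalerBl scaler_eq0 (negbTE e0) orbF -mulrBr mulf_eq0.
  by rewrite (negbTE two0) /= subr_eq0 => /eqP.
have fek : form e k = 1.
  have := form_bracketA h e k; rewrite ek fhh he formC formZr formC => E.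
  by apply: (mulfI two0); rewrite mulr1 -E.
have -> : forall a b c, form (a *: h + b *: e + c *: k) (a *: h + b *: e + c *: k) =
    a ^+ 2 * form h h + b ^+ 2 * form e e + c ^+ 2 * form k k + 2 * (a * b * form h e) +
    2 * (a * c * form h k) + 2 * (b * c * form e k).
  by move=> a b c; rewrite /form; coord; ring.
by rewrite fhh fee fkk fhe fhk fek /form; ring.
Qed.

(* A nonzero endomorphism of sl2 has trace equal to the sum of its principal 2x2 minors and
   determinant 1, hence 1 is an eigenvalue. *)
Lemma lie_hom_fixed (f : g -> g) : lie_hom f -> f (slH R) != 0 ->
  exists2 X, X != 0 & f X = X.
Proof.
move=> fh fH0; have := lie_hom_form fh fH0 (slH R).
have [he hk ek] := lie_hom_triple fh.
have fE X := lie_homE X fh; move: fE he hk ek.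
move: (f (slH R)) (f (slE R)) (f (slF R)) => h e k fE he hk ek hh.
have [x [y [z [xyz0 E1 E2 E3]]]] : exists x y z, [/\ (x, y, z) != (0, 0, 0),
    x * (cH h - 1) + y * cH e + z * cH k = 0, x * cE h + y * (cE e - 1) + z * cE k = 0 &
    x * cF h + y * cF e + z * (cF k - 1) = 0].
  apply: singular3.
  have two0 : 2 != 0 :> C by rewrite pnatr_eq0.
  have e2 : cH h * cE e - cE h * cH e = cE e.
    by have := congr1 (@cE R) he; coord => /(mulfI two0).
  have k3 : cH h * cF k - cF h * cH k = cF k.
    have := congr1 (@cF R) hk; coord; rewrite mulNr -mulrN => /(mulfI two0) E.
    by rewrite -[RHS]opprK -E; ring.
  have h1 : cE e * cF k - cF e * cE k = cH h by rewrite -ek; coord.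
  have h2 : 2 * (cH e * cE k - cE e * cH k) = cE h by rewrite -ek; coord.
  have h3 : 2 * (cF e * cH k - cH e * cF k) = cF h by rewrite -ek; coord.
  have hh' : cH h ^+ 2 + cE h * cF h = 1.
    apply: (mulfI two0); rewrite mulr1.
    transitivity (form h h); first by rewrite /form; ring.
    by rewrite hh /form; coord; ring.
  (* Twice det (f - 1) is arranged so that its minors become coordinates of [e, k], [h, e] and
     [h, k]. The trace then cancels the principal minors, and det f = [cH h ^+ 2 + cE h * cF h] =
     1. *)
  apply: (mulfI two0); rewrite mulr0.
  transitivity (2 * cH h * (cE e * cF k - cF e * cE k) +
    cE h * (2 * (cF e * cH k - cH e * cF k)) + cF h * (2 * (cH e * cE k - cE e * cH k)) -
    2 * (cH h * cE e - cE h * cH e) - 2 * (cH h * cF k - cF h * cH k) -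
    2 * (cE e * cF k - cF e * cE k) + 2 * (cH h + cE e + cF k) - 2); first by ring.
  rewrite h1 h2 h3 e2 k3; transitivity (2 * (cH h ^+ 2 + cE h * cF h) - 2); first by ring.
  by rewrite hh'; ring.
exists (sl2_mk x y z).
  apply: contra_neq xyz0 => X0.
  have := congr1 (@cH R) X0; have := congr1 (@cE R) X0; have := congr1 (@cF R) X0.
  by coord => -> -> ->.
rewrite fE; apply: sl2P; coord; apply/eqP; rewrite -subr_eq0; apply/eqP.
- by rewrite -[RHS]E1; ring.
- by rewrite -[RHS]E2; ring.
- by rewrite -[RHS]E3; ring.
Qed.

End LieHomomorphisms.

(** * Graphs, and the assembly of the cases *)

Section Classification.
Variable R : realType.
Notation C := R[i].
Notation g := (sl2 R).
Notation gC := (sl2_cplx R).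
Implicit Types (X Y A B e h : g) (Z W u v w : gC).

Lemma graph_model (q : set gC) : admissible q -> (forall Y, q (0, Y) -> Y = 0) ->
  (forall X, exists Y, q (X, Y)) -> q = modelI.
Proof.
move=> [lq q0 bq cq] inj /choice[phi phiq].
have uniq_q X Y Y' : q (X, Y) -> q (X, Y') -> Y = Y'.
  move=> XY XY'; apply/eqP; rewrite -subr_eq0; apply/eqP/inj.
  rewrite (_ : (0, _) = (-1) *: (X, Y') + (X, Y)); first exact: lq.
  by apply: gCP; rewrite !pairE scaleN1r ?addNr // addrC.
have ph : lie_hom phi.
  split=> [a X Y|X Y]; apply: uniq_q (phiq _) _; first exact: (lq a _ _ (phiq X) (phiq Y)).
  exact: (bq _ _ (phiq X) (phiq Y)).
have [H0|H0] := eqVneq (phi (slH R)) 0.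
  have [he hk _] := lie_hom_triple ph.
  have phi0 X : phi X = 0.
    have two0 : 2 != 0 :> C by rewrite pnatr_eq0.
    move: he hk; rewrite (lie_homE X ph) H0 !bracket0X => /esym/eqP he /esym/eqP hk.
    move: he hk; rewrite !scaler_eq0 oppr_eq0 (negbTE two0) /= => /eqP -> /eqP ->.
    by rewrite !scaler0 !addr0.
  apply/seteqP; split=> [[X Y] XY|[X Y]].
    by rewrite /modelI /= -(phi0 X); exact: uniq_q XY (phiq X).
  by rewrite /modelI /= => ->; rewrite -(phi0 X); exact: phiq.
(* The square of conj o phi is complex linear, although conj o phi is antilinear. It is nonzero
   because it preserves form H H = 2. *)
pose T X := conj_sl2 (phi (conj_sl2 (phi X))).
have Th : lie_hom T.
  split=> [a X Y|X Y]; rewrite /T.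
    by rewrite ph.1 conj_sl2D conj_sl2_scale ph.1 conj_sl2D conj_sl2_scale conjcK.
  by rewrite ph.2 conj_sl2_bracket ph.2 conj_sl2_bracket.
have pf := lie_hom_form ph H0.
have TH0 : T (slH R) != 0.
  have : form (T (slH R)) (T (slH R)) != 0.
    rewrite /T form_conj pf form_conj conjcK pf.
    rewrite (_ : form _ _ = 2) ?pnatr_eq0 //.
    by rewrite /form; coord; ring.
  by apply: contra_neq => ->; rewrite /form; coord; ring.
have [X X0 TX] := lie_hom_fixed Th TH0.
(* The conjugate of (X, phi X) is (conj (phi X), conj X), and T X = X says that this point lies on
   the graph. *)
have : ((X, phi X) : gC) = 0.
  apply: cq (phiq X) _; rewrite /cplx_conj /= -[in conj_sl2 X]TX /T conj_sl2K.
  exact: phiq.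
by move/(congr1 fst) => /= X0'; rewrite X0' eqxx in X0.
Qed.

Lemma dim_sl2 : (\dim {: g} <= 3)%N.
Proof.
apply: (@leq_trans (\dim <<[:: slH R; slE R; slF R]>>%VS)); last exact: dim_span.
apply/dimvS/subvP => X _; rewrite -(sl2_mkK X) sl2_mkDef.
apply: rpredD; [apply: rpredD|]; apply/rpredZ/memv_span.
- exact: (@mem_nth _ 0 [:: slH R; slE R; slF R] 0).
- exact: (@mem_nth _ 0 [:: slH R; slE R; slF R] 1).
- exact: (@mem_nth _ 0 [:: slH R; slE R; slF R] 2).
Qed.

(** A dimension count: the injective image of q has dimension 3 and thus exhausts sl2. *)
Lemma proj_onto (f : {linear gC -> g}) (q : {vspace gC}) : \dim q = 3%N ->
  (forall Z, Z \in q -> f Z = 0 -> Z = 0) -> forall X, exists2 Z, Z \in q & f Z = X.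
Proof.
move=> q3 inj X.
have : X \in (linfun f @: q)%VS.
  have -> : (linfun f @: q)%VS = fullv; last exact: memvf.
  apply/eqP; rewrite eqEdim subvf (leq_trans dim_sl2) // -q3.
  rewrite -(limg_ker_dim (linfun f) q) [X in (X + _)%N](_ : _ = 0%N) //.
  apply/eqP; rewrite dimv_eq0 -subv0; apply/subvP => Z.
  rewrite memv_cap memv_ker lfunE memv0 => /andP[Zq /eqP fZ].
  by apply/eqP; exact: inj.
by move=> /memv_imgP[Z Zq ->]; exists Z; rewrite ?lfunE.
Qed.

Lemma span_lin3 u v w : [set` <<[:: u; v; w]>>%VS] = lin3 u v w.
Proof.
apply/seteqP; split=> [Z /=|_ [x [y [z ->]]] /=].
  rewrite !span_cons span_nil addv0 => /memv_addP[_ /vlineP[x ->]].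
  move=> [_ /memv_addP[_ /vlineP[y ->] [_ /vlineP[z ->] ->]] ->].
  by exists x, y, z; rewrite addrA.
apply: rpredD; [apply: rpredD|]; apply/rpredZ/memv_span.
- exact: (@mem_nth _ 0 [:: u; v; w] 0).
- exact: (@mem_nth _ 0 [:: u; v; w] 1).
- exact: (@mem_nth _ 0 [:: u; v; w] 2).
Qed.

Lemma classification (q : {vspace gC}) : \dim q = 3%N -> admissible [set` q] ->
  has_model [set` q].
Proof.
move=> q3 adm; have [lq q0 bq cq] := adm.
have [[Y qY Y0]|n2] := pselect (exists2 Y, (0, Y) \in q & Y != 0); last first.
  apply: Or31; rewrite (graph_model adm); first exact: conj_refl.
    by move=> Y qY; apply/eqP/negP => /negP Y0; apply: n2; exists Y.
  have inj Z : Z \in q -> Z.1 = 0 -> Z = 0.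
    case: Z => X Y /= qZ X0; rewrite X0 in qZ *; congr (_, _).
    by apply/eqP/negP => /negP Y0; apply: n2; exists Y.
  move=> X; have [[X' Y] qZ /= <-] := proj_onto (f := fst) q3 inj X.
  by exists Y.
have [[X qX X0]|n1] := pselect (exists2 X, (X, 0) \in q & X != 0); last first.
  apply: has_model_swapV; apply: Or31.
  rewrite (graph_model (admissible_swapV adm)); first exact: conj_refl.
    move=> X [[X' Y'] /= qX [Y'0 XX']]; apply/eqP/negP => /negP X0; apply: n1.
    by exists X => //; rewrite -XX' -Y'0.
  have inj Z : Z \in q -> Z.2 = 0 -> Z = 0.
    case: Z => X' Y' /= qZ Y'0; rewrite Y'0 in qZ *; congr (_, _).
    by apply/eqP/negP => /negP X0; apply: n1; exists X'.
  move=> Y'; have [[X' Y''] qZ /= <-] := proj_onto (f := snd) q3 inj Y'.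
  by exists X', (X', Y'').
pose u : gC := (X, 0); pose v : gC := (0, Y).
(* As q has dimension 3, some vector of q outside the plane of u and v completes them to a basis. *)
have [W qW WXY] : exists2 W, W \in q & W \notin <<[:: u; v]>>%VS.
  have : ~~ (q <= <<[:: u; v]>>)%VS.
    apply/negP => /dimvS; rewrite q3 => /leq_trans/(_ (dim_span _)).
    by [].
  by move=> /subvPn[W]; exists W.
have E : [set` q] = lin3 u v W.
  have -> : q = <<[:: W; u; v]>>%VS.
    apply/esym/eqP; rewrite eqEdim; apply/andP; split.
      by apply/span_subvP => Z; rewrite !inE => /or3P[]/eqP->.
    rewrite q3; have /eqP -> // : free [:: W; u; v].
    rewrite free_cons WXY free_cons span_seq1 seq1_free /=; apply/andP; split.
      apply: contra X0 => /vlineP[c /(congr1 fst)] /=.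
      by rewrite scaler0 => ->.
    by apply: contra Y0 => /eqP[->].
  rewrite span_lin3.
  by apply: lin3_eq; [exact: lin3_2|exact: lin3_3|exact: lin3_1|
    exact: lin3_3|exact: lin3_1|exact: lin3_2].
rewrite E in adm *; case: W E adm qW WXY => [A B] E adm qW WXY.
apply: has_model_kernels => // -[x Ax [y By]].
case/negP: WXY; rewrite (_ : (A, B) = x *: u + y *: v).
  apply: rpredD; apply/rpredZ/memv_span; first exact: (@mem_nth _ 0 [:: u; v] 0).
  exact: (@mem_nth _ 0 [:: u; v] 1).
by apply: gCP; rewrite !pairE ?scaler0 ?addr0 ?add0r.
Qed.

End Classification.

(** * Open conditions in the Grassmannian *)

Section Continuity.
Variable R : realType.
Notation C := R[i].
Notation g := (sl2 R).
Notation gC := (sl2_cplx R).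
Implicit Types (T : topologicalType) (q : set gC).

(** Continuity is stated in coordinates, without giving sl2 a topology. *)
Definition continuous_sl2 T (F : T -> g) :=
  [/\ continuous (fun t => cH (F t)), continuous (fun t => cE (F t)) &
      continuous (fun t => cF (F t))].

Definition continuous_gC T (Z : T -> gC) :=
  continuous_sl2 (fun t => (Z t).1) /\ continuous_sl2 (fun t => (Z t).2).

Lemma continuous_add T (f h : T -> C) : continuous f -> continuous h ->
  continuous (fun t => f t + h t).
Proof. by move=> cf ch t; exact: (continuousD (cf t) (ch t)). Qed.

Lemma continuous_opp T (f : T -> C) : continuous f -> continuous (fun t => - f t).
Proof. by move=> cf t; exact: (continuousN (cf t)). Qed.

Lemma continuous_mul T (f h : T -> C) : continuous f -> continuous h ->
  continuous (fun t => f t * h t).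
Proof. by move=> cf ch t; exact: (continuousM (cf t) (ch t)). Qed.

Lemma continuous_const T (c : C) : continuous (fun _ : T => c).
Proof. by move=> t; exact: cst_continuous. Qed.

Lemma continuous_sl2_cst T (X : g) : continuous_sl2 (fun _ : T => X).
Proof. by split; exact: continuous_const. Qed.

Lemma continuous_form T (F G : T -> g) : continuous_sl2 F -> continuous_sl2 G ->
  continuous (fun t => form (F t) (G t)).
Proof.
move=> [Fh Fe Ff] [Gh Ge Gf].
have c2 := @continuous_const T 2; have cc := continuous_mul c2 (continuous_mul Fh Gh).
exact: continuous_add (continuous_add cc (continuous_mul Fe Gf)) (continuous_mul Ff Ge).
Qed.

Lemma continuous_bracket T (F G : T -> g) : continuous_sl2 F -> continuous_sl2 G ->
  continuous_sl2 (fun t => bracket (F t) (G t)).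
Proof.
move=> [Fh Fe Ff] [Gh Ge Gf]; have c2 := @continuous_const T 2.
split; under eq_fun do rewrite sl2_coord_bracket.
- exact: continuous_add (continuous_mul Fe Gf) (continuous_opp (continuous_mul Ff Ge)).
- apply: continuous_mul c2 _.
  exact: continuous_add (continuous_mul Fh Ge) (continuous_opp (continuous_mul Fe Gh)).
- apply: continuous_mul c2 _.
  exact: continuous_add (continuous_mul Ff Gh) (continuous_opp (continuous_mul Fh Gf)).
Qed.

Lemma continuous_mx_linear m n (f : 'M[C]_(m, n) -> C) :
  (forall a A B, f (a *: A + B) = a * f A + f B) -> continuous f.
Proof.
move=> fl; have f0 : f 0 = 0 by have := fl (-1) 0 0; rewrite scaler0 addr0 mulN1r addNr.
have fE A : f A = \sum_i \sum_j A i j * f (delta_mx i j).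
  have fsum I (s : seq I) (F : I -> 'M[C]_(m, n)) : f (\sum_(i <- s) F i) = \sum_(i <- s) f (F i).
    elim: s => [|i s IH]; first by rewrite !big_nil f0.
    by rewrite !big_cons -[F i]scale1r fl IH mul1r scale1r.
  rewrite {1}(matrix_sum_delta A) fsum; apply: eq_bigr => i _; rewrite fsum.
  by apply: eq_bigr => j _; rewrite -[_ *: _]addr0 fl f0 addr0.
have csum (I : Type) (s : seq I) (F : I -> 'M[C]_(m, n) -> C) :
    (forall i, continuous (F i)) -> continuous (fun A => \sum_(i <- s) F i A).
  move=> cF; elim: s => [|i s IH].
    by under eq_fun do rewrite big_nil; exact: continuous_const.
  by under eq_fun do rewrite big_cons; exact: continuous_add (cF i) IH.
rewrite (_ : f = fun A => \sum_i \sum_j A i j * f (delta_mx i j)); last exact/funext.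
apply: (csum) => i; apply: (csum) => j; apply: continuous_mul; last exact: continuous_const.
exact: coord_continuous.
Qed.

Lemma open_norm_lt T (f h : T -> C) : continuous f -> continuous h ->
  open [set t | (`|f t| : C) < `|h t|].
Proof.
move=> cf ch; rewrite openE => t /= fh; rewrite /interior.
(* Half of the gap: both functions may move by less than e without closing it. *)
pose e := (`|h t| - `|f t|) / 2.
have e0 : 0 < e by rewrite divr_gt0 ?subr_gt0 ?ltr0n.
have /cvgrPdist_lt/(_ e e0) nf := cf t; have /cvgrPdist_lt/(_ e e0) nh := ch t.
near=> s => /=.
have fs : `|f t - f s| < e by near: s.
have hs : `|h t - h s| < e by near: s.
have A1 : `|f s| < `|f t| + e.
  by rewrite -[f s](subrK (f t)) addrC (le_lt_trans (ler_normD _ _)) // ltrD2l distrC.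
have A2 : `|h t| - e < `|h s|.
  by rewrite ltrBlDr -[h t](subrK (h s)) addrC (le_lt_trans (ler_normD _ _)) // ltrD2l.
apply: (lt_trans A1); rewrite (_ : `|f t| + e = `|h t| - e) //.
by rewrite /e; field.
Unshelve. all: by end_near. Qed.

End Continuity.

(** * Conditions given by strict inequalities *)

Section OpenConditions.
Variable R : realType.
Notation C := R[i].
Notation g := (sl2 R).
Notation gC := (sl2_cplx R).
Implicit Types (T : topologicalType) (q : set gC).

Definition open_condition (P : set gC -> Prop) :=
  open [set q : grassmannian 3 gC | P [set` \val q]].

Lemma open_condition_and (P Q : set gC -> Prop) :
  open_condition P -> open_condition Q -> open_condition (fun q => P q /\ Q q).
Proof. exact: openI. Qed.

Lemma open_condition_or (P Q : set gC -> Prop) :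
  open_condition P -> open_condition Q -> open_condition (fun q => P q \/ Q q).
Proof. exact: openU. Qed.

Lemma open_condition_ex (I : Type) (P : I -> set gC -> Prop) :
  (forall i, open_condition (P i)) -> open_condition (fun q => exists i, P i q).
Proof.
move=> Po; rewrite /open_condition.
rewrite (_ : [set _ | _] = \bigcup_(i in setT) [set q : grassmannian 3 gC | P i [set` \val q]]).
  by apply: bigcup_open => i _; exact: Po.
apply/seteqP; split=> q [j]; first by move=> Pj; exists j.
by move=> _ Pj; exists j.
Qed.

(** Quantifying over parametrised pairs makes the notion applicable to vectors that depend on a
    frame. *)
Definition continuous_gC2 (f : gC -> gC -> C) := forall T (Z W : T -> gC),
  continuous_gC Z -> continuous_gC W -> continuous (fun t => f (Z t) (W t)).

Definition some_lt (f h : gC -> gC -> C) q :=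
  exists Z W, [/\ q Z, q W & (`|f Z W| : C) < `|h Z W|].

Lemma linear_r2v (c : 'rV[C]_3) a (A B : 'M[C]_(3, dim gC)) :
  r2v (c *m (a *: A + B)) = a *: r2v (c *m A) + r2v (c *m B) :> gC.
Proof. by rewrite mulmxDr -scalemxAr linearP. Qed.

Lemma continuous_frame (c : 'rV[C]_3) :
  continuous_gC (fun A : frame 3 gC => r2v (c *m set_val A) : gC).
Proof.
have cl (f : 'M[C]_(3, dim gC) -> C) : (forall a A B, f (a *: A + B) = a * f A + f B) ->
    continuous (fun A : frame 3 gC => f (set_val A)).
  move=> fl A; apply: continuous_comp; last exact: continuous_mx_linear.
  exact: initial_continuous.
by do 2 split; apply: (cl (fun A => _ (_ (r2v (c *m A))))) => a A B;
  rewrite linear_r2v !pairE !coordE.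
Qed.

Lemma mem_span_frame (A : frame 3 gC) (Z : gC) :
  (Z \in \val (span_frame A)) <-> exists c : 'rV[C]_3, Z = r2v (c *m set_val A).
Proof.
have E c : r2v (c *m set_val A) = \sum_i c 0 i *: (frame_vectors A)`_i :> gC.
  rewrite mulmx_sum_row linear_sum; apply: eq_bigr => i _.
  by rewrite linearZ (nth_map i) ?nth_ord_enum ?size_enum_ord.
split=> [/coord_span ->|[c ->]].
  exists (\row_i coord (frame_vectors A) i Z); rewrite E; apply: eq_bigr => i _.
  by rewrite mxE.
rewrite E; apply: rpred_sum => i _; apply/rpredZ/memv_span.
by apply: mem_nth; rewrite size_tuple.
Qed.

(** On frames, Z and W are combinations of the rows with coefficients c and c'. The preimage is the
    union over (c, c') of the sets where a strict inequality holds between continuous functions of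
    the frame. *)
Lemma open_some_lt (f h : gC -> gC -> C) : continuous_gC2 f -> continuous_gC2 h ->
  open_condition (some_lt f h).
Proof.
move=> cf ch; rewrite /open_condition; change (open (@span_frame R 3 gC @^-1`
  [set q : grassmannian 3 gC | some_lt f h [set` \val q]])).
pose v (c : 'rV[C]_3) (A : frame 3 gC) : gC := r2v (c *m set_val A).
rewrite (_ : _ @^-1` _ = \bigcup_(c in [set: 'rV[C]_3 * 'rV[C]_3])
   [set A | (`|f (v c.1 A) (v c.2 A)| : C) < `|h (v c.1 A) (v c.2 A)|]).
  apply: bigcup_open => -[c c'] _; apply: open_norm_lt.
    by apply: (cf _ (v c) (v c')); exact: continuous_frame.
  by apply: (ch _ (v c) (v c')); exact: continuous_frame.
apply/seteqP; split=> A.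
  move=> [_ [_ [/mem_span_frame[c ->] /mem_span_frame[c' ->] H]]].
  by exists (c, c').
move=> [[c c'] _ /= H]; exists (v c A), (v c' A); split => //; apply/mem_span_frame.
  by exists c.
by exists c'.
Qed.

End OpenConditions.

(** * The invariant conditions *)

Section Conditions.
Variable R : realType.
Notation C := R[i].
Notation g := (sl2 R).
Notation gC := (sl2_cplx R).
Implicit Types (T : topologicalType) (q : set gC) (Z W : gC) (U V : g).

Definition normsq1 Z (W : gC) : C := form Z.1 Z.1.
Definition normsq2 Z (W : gC) : C := form Z.2 Z.2.
(** Gram determinants, which vanish where the trace form of the summand has rank at most 1. *)
Definition gram1 Z W : C := form Z.1 Z.1 * form W.1 W.1 - form Z.1 W.1 * form Z.1 W.1.
Definition gram2 Z W : C := form Z.2 Z.2 * form W.2 W.2 - form Z.2 W.2 * form Z.2 W.2.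
(** The test vector U extracts scalars from [Z, W] and [Z, [Z, W]], whose ratio on II is an
    eigenvalue of ad Z. *)
Definition pair1 U Z W : C := form (bracket Z.1 W.1) U.
Definition pair2 U Z W : C := form (bracket Z.2 W.2) U.
Definition pair1' U Z W : C := form (bracket Z.1 (bracket Z.1 W.1)) U.
Definition pair2' U Z W : C := form (bracket Z.2 (bracket Z.2 W.2)) U.

(** One of the trace forms has rank at least 2, which singles out I. *)
Definition condI q := some_lt (fun _ _ => 0) gram1 q \/ some_lt (fun _ _ => 0) gram2 q.

(** Neither trace form dominates the other in absolute value, which singles out III. *)
Definition condIII q := some_lt normsq1 normsq2 q /\ some_lt normsq2 normsq1 q.

(** The form being nondegenerate, this says that both projections are nonzero, which excludes I. *)
Definition cond_proj q :=
  (exists U, some_lt (fun _ _ => 0) (fun Z _ => form Z.1 U) q) /\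
  (exists U, some_lt (fun _ _ => 0) (fun Z _ => form Z.2 U) q).

(** Since N2 = l^2 N1 on II_l, taking a = e^2 yields |l| < e. The two alternatives make the
    condition stable under the exchange of summands. *)
Definition cond_ratio (a : C) q :=
  some_lt normsq2 (fun Z W => a * normsq1 Z W) q \/
  some_lt normsq1 (fun Z W => a * normsq2 Z W) q.

(* On the model II with parameter l, ad Z has the eigenvalues 2x and -2xl on the
   two components of [Z, W], so that the left-hand side is a multiple of m - l. *)
Definition cond_param (m a : C) q :=
  (exists U V, some_lt (fun Z W => pair2' V Z W * pair1 U Z W + m * (pair2 V Z W * pair1' U Z W))
    (fun Z W => a * (pair2 V Z W * pair1' U Z W)) q) \/
  (exists U V, some_lt (fun Z W => pair1' V Z W * pair2 U Z W + m * (pair1 V Z W * pair2' U Z W))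
    (fun Z W => a * (pair1 V Z W * pair2' U Z W)) q).

Lemma continuous_gC2_cst (c : C) : continuous_gC2 (fun _ _ : gC => c).
Proof. by move=> T Z W _ _; exact: continuous_const. Qed.

Lemma continuous_gC2_add (f h : gC -> gC -> C) : continuous_gC2 f -> continuous_gC2 h ->
  continuous_gC2 (fun Z W => f Z W + h Z W).
Proof. by move=> cf ch T Z W cZ cW; exact: continuous_add (cf _ _ _ cZ cW) (ch _ _ _ cZ cW). Qed.

Lemma continuous_gC2_mul (f h : gC -> gC -> C) : continuous_gC2 f -> continuous_gC2 h ->
  continuous_gC2 (fun Z W => f Z W * h Z W).
Proof. by move=> cf ch T Z W cZ cW; exact: continuous_mul (cf _ _ _ cZ cW) (ch _ _ _ cZ cW). Qed.

Lemma continuous_normsq1 : continuous_gC2 normsq1.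
Proof. by move=> T Z W [cZ _] _; exact: continuous_form. Qed.
Lemma continuous_normsq2 : continuous_gC2 normsq2.
Proof. by move=> T Z W [_ cZ] _; exact: continuous_form. Qed.

Lemma continuous_gram1 : continuous_gC2 gram1.
Proof.
move=> T Z W [cZ _] [cW _].
have ff := continuous_mul (continuous_form cZ cZ) (continuous_form cW cW).
have cc := continuous_form cZ cW.
exact: continuous_add ff (continuous_opp (continuous_mul cc cc)).
Qed.
Lemma continuous_gram2 : continuous_gC2 gram2.
Proof.
move=> T Z W [_ cZ] [_ cW].
have ff := continuous_mul (continuous_form cZ cZ) (continuous_form cW cW).
have cc := continuous_form cZ cW.
exact: continuous_add ff (continuous_opp (continuous_mul cc cc)).
Qed.

Lemma continuous_pairs U :
  [/\ continuous_gC2 (pair1 U), continuous_gC2 (pair2 U),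
      continuous_gC2 (pair1' U) & continuous_gC2 (pair2' U)].
Proof.
split=> T Z W [cZ1 cZ2] [cW1 cW2].
- exact: continuous_form (continuous_bracket cZ1 cW1) (continuous_sl2_cst _ U).
- exact: continuous_form (continuous_bracket cZ2 cW2) (continuous_sl2_cst _ U).
- exact: continuous_form (continuous_bracket cZ1 (continuous_bracket cZ1 cW1))
    (continuous_sl2_cst _ U).
- exact: continuous_form (continuous_bracket cZ2 (continuous_bracket cZ2 cW2))
    (continuous_sl2_cst _ U).
Qed.

Lemma open_condI : open_condition condI.
Proof.
have c0 := @continuous_gC2_cst 0.
exact: open_condition_or (open_some_lt c0 continuous_gram1) (open_some_lt c0 continuous_gram2).
Qed.

Lemma open_condIII : open_condition condIII.
Proof.
have c1 := continuous_normsq1; have c2 := continuous_normsq2.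
exact: open_condition_and (open_some_lt c1 c2) (open_some_lt c2 c1).
Qed.

Lemma open_cond_proj : open_condition cond_proj.
Proof.
have c0 := @continuous_gC2_cst 0.
have c1 U : continuous_gC2 (fun Z _ => form Z.1 U).
  by move=> T Z W [cZ _] _; exact: continuous_form cZ (continuous_sl2_cst _ U).
have c2 U : continuous_gC2 (fun Z _ => form Z.2 U).
  by move=> T Z W [_ cZ] _; exact: continuous_form cZ (continuous_sl2_cst _ U).
exact: open_condition_and (open_condition_ex (fun U => open_some_lt c0 (c1 U)))
  (open_condition_ex (fun U => open_some_lt c0 (c2 U))).
Qed.

Lemma open_cond_ratio a : open_condition (cond_ratio a).
Proof.
have ca := @continuous_gC2_cst a.
have c1 := continuous_normsq1; have c2 := continuous_normsq2.
exact: open_condition_or (open_some_lt c2 (continuous_gC2_mul ca c1))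
  (open_some_lt c1 (continuous_gC2_mul ca c2)).
Qed.

Lemma open_cond_param m a : open_condition (cond_param m a).
Proof.
have ca := @continuous_gC2_cst a; have cm := @continuous_gC2_cst m.
have c1 U V : open_condition (some_lt
    (fun Z W => pair2' V Z W * pair1 U Z W + m * (pair2 V Z W * pair1' U Z W))
    (fun Z W => a * (pair2 V Z W * pair1' U Z W))).
  have [u1 _ u1' _] := continuous_pairs U; have [_ v2 _ v2'] := continuous_pairs V.
  have c := continuous_gC2_mul v2 u1'.
  exact: open_some_lt (continuous_gC2_add (continuous_gC2_mul v2' u1) (continuous_gC2_mul cm c))
    (continuous_gC2_mul ca c).
have c2 U V : open_condition (some_lt
    (fun Z W => pair1' V Z W * pair2 U Z W + m * (pair1 V Z W * pair2' U Z W))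
    (fun Z W => a * (pair1 V Z W * pair2' U Z W))).
  have [_ u2 _ u2'] := continuous_pairs U; have [v1 _ v1' _] := continuous_pairs V.
  have c := continuous_gC2_mul v1 u2'.
  exact: open_some_lt (continuous_gC2_add (continuous_gC2_mul v1' u2) (continuous_gC2_mul cm c))
    (continuous_gC2_mul ca c).
exact: open_condition_or (open_condition_ex (fun U => open_condition_ex (c1 U)))
  (open_condition_ex (fun U => open_condition_ex (c2 U))).
Qed.

Lemma some_lt_image (phi : gC -> gC) (f h f' h' : gC -> gC -> C) q :
  (forall Z W, f' (phi Z) (phi W) = f Z W) -> (forall Z W, h' (phi Z) (phi W) = h Z W) ->
  some_lt f h q -> some_lt f' h' (phi @` q).
Proof.
move=> ff hh [Z [W [qZ qW fh]]]; exists (phi Z), (phi W); split; [by exists Z|by exists W|].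
by rewrite ff hh.
Qed.

Lemma stable_condI : conj_stable condI.
Proof.
split=> [q p r s t d|q]; last first.
  by case=> h; [right|left]; exact: some_lt_image h.
have dc := det1_conj d.
by case=> h; [left|right]; apply: some_lt_image h => // Z W;
  rewrite /gram1 /gram2 /adV /= !form_Ad.
Qed.

Lemma stable_condIII : conj_stable condIII.
Proof.
split=> [q p r s t d|q] [h1 h2]; last first.
  by split; [exact: some_lt_image h2|exact: some_lt_image h1].
have dc := det1_conj d.
by split; [apply: some_lt_image h1|apply: some_lt_image h2] => Z W;
  rewrite /normsq1 /normsq2 /adV /= form_Ad.
Qed.

Lemma stable_cond_ratio a : conj_stable (cond_ratio a).
Proof.
split=> [q p r s t d|q]; last first.
  by case=> h; [right|left]; exact: some_lt_image h.
have dc := det1_conj d.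
by case=> h; [left|right]; apply: some_lt_image h => Z W;
  rewrite /normsq1 /normsq2 /adV /= form_Ad.
Qed.

Lemma stable_cond_proj : conj_stable cond_proj.
Proof.
split=> [q p r s t d|q] [[U h1] [V h2]]; last first.
  by split; [exists V; exact: some_lt_image h2|exists U; exact: some_lt_image h1].
have dc := det1_conj d.
split; [exists (Ad p r s t U); apply: some_lt_image h1
  |exists (Ad p^* r^* s^* t^* V); apply: some_lt_image h2] => // Z W.
  by rewrite /adV /= form_Ad.
by rewrite /adV /= form_Ad.
Qed.

Lemma pair_adV p r s t U Z W : p * t - r * s = 1 ->
  let a := Ad p r s t in let a' := Ad p^* r^* s^* t^* in let f := adV p r s t in
  [/\ pair1 (a U) (f Z) (f W) = pair1 U Z W, pair1' (a U) (f Z) (f W) = pair1' U Z W,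
      pair2 (a' U) (f Z) (f W) = pair2 U Z W & pair2' (a' U) (f Z) (f W) = pair2' U Z W].
Proof.
move=> d a a' f; have dc := det1_conj d.
rewrite /pair1 /pair1' /pair2 /pair2' /f /adV /a /a'.
by split; rewrite !pairE -!Ad_bracket // form_Ad.
Qed.

Lemma stable_cond_param m a : conj_stable (cond_param m a).
Proof.
split=> [q p r s t d|q]; last first.
  by case=> -[U [V h]]; [right|left]; exists U, V; exact: some_lt_image h.
case=> -[U [V h]]; [left|right].
  exists (Ad p r s t U), (Ad p^* r^* s^* t^* V); apply: some_lt_image h => Z W;
  have [e1 e2 _ _] := pair_adV U Z W d; have [_ _ e3 e4] := pair_adV V Z W d;
  by rewrite ?(e1, e2, e3, e4).
exists (Ad p^* r^* s^* t^* U), (Ad p r s t V); apply: some_lt_image h => Z W;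
have [_ _ e1 e2] := pair_adV U Z W d; have [e3 e4 _ _] := pair_adV V Z W d;
by rewrite ?(e1, e2, e3, e4).
Qed.

End Conditions.

(** * Values of the conditions on the models *)

Section ModelConditions.
Variable R : realType.
Notation C := R[i].
Notation g := (sl2 R).
Notation gC := (sl2_cplx R).
Implicit Types (q : set gC) (Z W : gC) (U V : g) (l : C).

Lemma normr_lt00 (x y : C) : y = 0 -> ~ ((`|x| : C) < `|y|).
Proof. by move=> ->; rewrite normr0 normr_lt0. Qed.

(** [Z.1, W.1] is a multiple of E, on which ad Z.1 has eigenvalue 2 cH Z.1. In the second summand F
    takes the place of E, with eigenvalue -2 cH Z.2. *)
Lemma bracket_modelII1 l Z W : modelII l Z -> modelII l W ->
  bracket Z.1 (bracket Z.1 W.1) = (2 * cH Z.1) *: bracket Z.1 W.1.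
Proof. by move=> [z _ _] [w _ _]; apply: sl2P; coord; rewrite ?z ?w; ring. Qed.

Lemma bracket_modelII2 l Z W : modelII l Z -> modelII l W ->
  bracket Z.2 (bracket Z.2 W.2) = (- 2 * l * cH Z.1) *: bracket Z.2 W.2.
Proof. by move=> [_ z z'] [_ w w']; apply: sl2P; coord; rewrite ?z ?w ?z' ?w'; ring. Qed.

Lemma formZl a U V : form (a *: U) V = a * form U V.
Proof. by rewrite formC formZr formC. Qed.

Lemma pair_modelII l U Z W : modelII l Z -> modelII l W ->
  pair1' U Z W = 2 * cH Z.1 * pair1 U Z W /\ pair2' U Z W = - 2 * l * cH Z.1 * pair2 U Z W.
Proof.
move=> qZ qW; rewrite /pair1' /pair2' (bracket_modelII1 qZ qW) (bracket_modelII2 qZ qW).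
by rewrite !formZl.
Qed.

Lemma form_modelII l Z W : modelII l Z -> modelII l W ->
  form Z.1 W.1 = 2 * cH Z.1 * cH W.1 /\ form Z.2 W.2 = 2 * l ^+ 2 * (cH Z.1 * cH W.1).
Proof. by move=> [z e h] [w e' h']; rewrite /form z w e e' h h'; split; ring. Qed.

Lemma form_modelIII Z W : modelIII Z -> modelIII W ->
  form Z.1 W.1 = 2 * cH Z.1 * cH W.1 /\ form Z.2 W.2 = 2 * cH Z.2 * cH W.2.
Proof. by move=> [z e h] [w e' h']; rewrite /form z w e e' h h'; split; ring. Qed.

Lemma condI_modelI : condI (@modelI R).
Proof.
left; exists (slH R, 0), (slE R + slF R, 0); split=> //.
rewrite normr0 normr_gt0 (_ : gram1 _ _ = 4) ?pnatr_eq0 // /gram1 /form; coord; ring.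
Qed.

Lemma condI_modelII l : ~ condI (modelII l).
Proof.
case=> -[Z [W [qZ qW]]]; apply: normr_lt00; rewrite /gram1 /gram2.
  by rewrite (form_modelII qZ qZ).1 (form_modelII qW qW).1 (form_modelII qZ qW).1; ring.
by rewrite (form_modelII qZ qZ).2 (form_modelII qW qW).2 (form_modelII qZ qW).2; ring.
Qed.

Lemma condI_modelIII : ~ condI (@modelIII R).
Proof.
case=> -[Z [W [qZ qW]]]; apply: normr_lt00; rewrite /gram1 /gram2.
  by rewrite (form_modelIII qZ qZ).1 (form_modelIII qW qW).1 (form_modelIII qZ qW).1; ring.
by rewrite (form_modelIII qZ qZ).2 (form_modelIII qW qW).2 (form_modelIII qZ qW).2; ring.
Qed.

Lemma condIII_modelI : ~ condIII (@modelI R).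
Proof.
case=> -[Z [W [qZ _ h]]] _; move: h; apply: normr_lt00; rewrite /normsq2 qZ.
by rewrite /form; coord; ring.
Qed.

Lemma normsq_modelII l Z W : modelII l Z -> normsq2 Z W = l ^+ 2 * normsq1 Z W.
Proof.
by move=> qZ; rewrite /normsq1 /normsq2 (form_modelII qZ qZ).1 (form_modelII qZ qZ).2; ring.
Qed.

(** |N2| = |l|^2 |N1| never exceeds |N1|. *)
Lemma condIII_modelII l : disk R l -> ~ condIII (modelII l).
Proof.
rewrite /disk /= => l1 [[Z [W [qZ qW h]]] _]; move: h; rewrite (normsq_modelII _ qZ) normrM normrX.
apply/negP; rewrite -real_leNgt ?normr_real ?realM ?realX ?normr_real //.
by rewrite ler_piMl // exprn_ile1 // ltW.
Qed.

Lemma condIII_modelIII : condIII (@modelIII R).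
Proof.
split.
  exists (0, slH R + slF R), 0; split; [by split; coord; ring|by split; coord; ring|].
  rewrite /normsq1 /normsq2 /form; coord.
  by rewrite !(mulr0, mul0r, addr0, add0r, mulr1, subr0) normr0 normr_gt0 pnatr_eq0.
exists (slH R, 0), 0; split; [by split; coord; ring|by split; coord; ring|].
rewrite /normsq1 /normsq2 /form; coord.
by rewrite !(mulr0, mul0r, addr0, add0r, mulr1, subr0) normr0 normr_gt0 pnatr_eq0.
Qed.

Lemma cond_proj_modelI : ~ cond_proj (@modelI R).
Proof.
case=> _ [U [Z [W [qZ _]]]]; apply: normr_lt00; rewrite qZ.
by rewrite /form; coord; ring.
Qed.

Lemma cond_proj_modelII l : cond_proj (modelII l).
Proof.
split.
  exists (slF R), (slE R, 0), 0; split; [by split; coord; ring|by split; coord; ring|].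
  rewrite /form; coord.
  by rewrite !(mulr0, mul0r, addr0, add0r, mulr1, subr0) normr0 normr_gt0 oner_eq0.
exists (slE R), (0, slF R), 0; split; [by split; coord; ring|by split; coord; ring|].
rewrite /form; coord.
by rewrite !(mulr0, mul0r, addr0, add0r, mulr1, subr0) normr0 normr_gt0 oner_eq0.
Qed.

Lemma cond_ratio_model0 a : 0 < a -> cond_ratio a (@modelII R 0).
Proof.
move=> a0; left; exists (slH R, 0), 0; split; [by split; coord; ring|by split; coord; ring|].
rewrite /normsq1 /normsq2 /form; coord.
rewrite !(mulr0, mul0r, addr0, add0r, mulr1, subr0) normr0 normr_gt0.
by rewrite mulf_neq0 ?pnatr_eq0 // gt_eqF.
Qed.

Lemma cond_ratio_modelII e l : 0 < e -> disk R l -> cond_ratio (e ^+ 2) (modelII l) -> `|l| < e.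
Proof.
rewrite /disk /= => e0 l1 [] [Z [W [qZ qW]]]; rewrite (normsq_modelII _ qZ) !normrM.
  rewrite -!expr2 (gtr0_norm e0) => h.
  have [n0|n0] := eqVneq (normsq1 Z W) 0; first by move: h; rewrite n0 normr0 !mulr0 ltxx.
  by move: h; rewrite ltr_pM2r ?normr_gt0 // ltr_pXn2r ?nnegrE ?normr_ge0 // ltW.
(* The exchanged alternative gives |l| < 1 < e |l| < e. *)
rewrite -!expr2 mulrA (gtr0_norm e0) -exprMn => h.
have [n0|n0] := eqVneq (normsq1 Z W) 0; first by move: h; rewrite n0 normr0 !mulr0 ltxx.
have {}h : 1 < (e * `|l|) ^+ 2 by rewrite -(ltr_pM2r (x := `|normsq1 Z W|)) ?normr_gt0 // mul1r.
have {}h : 1 < e * `|l|.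
  by move: h; rewrite -{1}(expr1n _ 2) ltr_pXn2r ?nnegrE ?ler01 // mulr_ge0 // ltW.
have l0 : 0 < `|l| by rewrite normr_gt0; apply: contraTneq h => ->; rewrite normr0 mulr0 lt_gtF ?ltr01.
apply: (lt_trans l1); apply: (lt_trans h); rewrite -[X in _ < X]mulr1.
by rewrite ltr_pM2l.
Qed.

Lemma cond_param_modelI m a : ~ cond_param m a (@modelI R).
Proof.
by case=> -[U [V [Z [W [qZ qW]]]]]; apply: normr_lt00;
  rewrite /pair2 /pair2' qZ !bracket0X /form; coord; ring.
Qed.

(** The second projection is a line, so [Z.2, W.2] = 0 and every product in the condition
    vanishes. *)
Lemma cond_param_modelIII m a : ~ cond_param m a (@modelIII R).
Proof.
have E Z W : modelIII Z -> modelIII W -> bracket Z.2 W.2 = 0.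
  by move=> [_ e h] [_ e' h']; apply: sl2P; coord; rewrite ?e ?e' ?h ?h'; ring.
by case=> -[U [V [Z [W [qZ qW]]]]]; apply: normr_lt00;
  rewrite /pair2 /pair2' (E _ _ qZ qW) ?bracketX0 /form; coord; ring.
Qed.

(** For Z = (H, mH) and W = (E, F) the left-hand side is 0 and the right-hand side is a nonzero
    multiple of am, whence the separate treatment of m = 0. *)
Lemma cond_param_self (m a : C) : m != 0 -> 0 < a -> cond_param m a (modelII m).
Proof.
move=> m0 a0; left; exists (slF R), (slE R), (slH R, m *: slH R), (slE R, slF R).
have qZ : modelII m (slH R, m *: slH R) by split; coord; ring.
have qW : modelII m (slE R, slF R) by split; coord; ring.
split=> //; have [-> _] := pair_modelII (slF R) qZ qW.
have [_ ->] := pair_modelII (slE R) qZ qW.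
rewrite [X in `|X| < _](_ : _ = 0); last by ring.
rewrite normr0 normr_gt0 /pair1 /pair2 /form; coord.
rewrite !(mulr0, mul0r, addr0, add0r, mulr1, subr0, mul1r, sub0r).
by rewrite !mulf_neq0 ?oppr_eq0 ?pnatr_eq0 ?(gt_eqF a0) // mulf_neq0 ?pnatr_eq0.
Qed.

Lemma cond_param_modelII (m a : C) l : disk R l -> 0 < a -> a <= 1 - `|m| ->
  cond_param m a (modelII l) -> `|m - l| < a.
Proof.
rewrite /disk /= => l1 a0 am [] [U [V [Z [W [qZ qW]]]]].
  have [-> _] := pair_modelII U qZ qW; have [_ ->] := pair_modelII V qZ qW.
  (* Both sides share the factor 2xpr, nonzero by strictness; |m - l| < a remains. *)
  set p := pair1 U Z W; set r := pair2 V Z W; set x := cH Z.1.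
  rewrite (_ : _ + _ = (m - l) * (2 * x * p * r)); last by ring.
  rewrite (_ : a * _ = a * (2 * x * p * r)); last by ring.
  move=> h; have {h} : `|m - l| * `|2 * x * p * r| < a * `|2 * x * p * r|.
    by rewrite -{1}(gtr0_norm a0) -!normrM.
  move=> h.
  have [n0|n0] := eqVneq (2 * x * p * r) 0; first by move: h; rewrite n0 normr0 !mulr0 ltxx.
  by move: h; rewrite ltr_pM2r ?normr_gt0.
have [_ ->] := pair_modelII U qZ qW; have [-> _] := pair_modelII V qZ qW.
set p := pair2 U Z W; set r := pair1 V Z W; set x := cH Z.1.
rewrite (_ : _ + _ = (1 - m * l) * (2 * x * p * r)); last by ring.
rewrite (_ : a * _ = (- a * l) * (2 * x * p * r)); last by ring.
move=> h; have {h} : `|1 - m * l| * `|2 * x * p * r| < `|- a * l| * `|2 * x * p * r|.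
  by rewrite -!normrM.
move=> h; have [n0|n0] := eqVneq (2 * x * p * r) 0; first by move: h; rewrite n0 normr0 !mulr0 ltxx.
move: h; rewrite ltr_pM2r ?normr_gt0 // mulNr normrN normrM (gtr0_norm a0) => h.
(* The exchanged alternative |1 - ml| < a|l| is impossible: |1 - ml| >= 1 - |m||l| > (1 - |m|)|l| >=
   a|l|. *)
have h2 : 1 - `|m| * `|l| <= `|1 - m * l|.
  by rewrite -normrM -{1}(normr1 C) lerB_dist.
have h3 : a * `|l| < 1 - `|m| * `|l|.
  apply: (@le_lt_trans _ _ ((1 - `|m|) * `|l|)); first by rewrite ler_wpM2r.
  by rewrite mulrBl mul1r ltrD2r.
by move: (lt_le_trans h3 h2) => /lt_trans/(_ h); rewrite ltxx.
Qed.

End ModelConditions.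

(** * The topology of the orbit space *)

Section Quotient.
Variable R : realType.
Notation C := R[i].
Notation g := (sl2 R).
Notation gC := (sl2_cplx R).
Implicit Types (q : QSpace R) (l : disk R) (U : set (orbit_space R)).

Definition subset_of q : set gC := [set` subspace_of q].

Lemma subset_of_II l : subset_of (II l) = modelII (set_val l).
Proof.
rewrite /subset_of subspace_of_II modelIIE span_lin3.
by apply: lin3_eq; [exact: lin3_2|exact: lin3_1|exact: lin3_3|
  exact: lin3_2|exact: lin3_1|exact: lin3_3].
Qed.

Lemma subset_of_III : subset_of III = modelIII.
Proof.
rewrite /subset_of subspace_of_III modelIIIE span_lin3.
by apply: lin3_eq; [exact: lin3_2|exact: lin3_1|exact: lin3_3|
  exact: lin3_2|exact: lin3_1|exact: lin3_3].
Qed.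

Lemma has_model_subset q : has_model (subset_of q).
Proof.
have [alg cap _] : complex_structures R (set_val q) by exact: set_valP.
apply: classification; first exact/eqP/(valP (set_val q)).
split=> [a Z W|||Z /= qZ qZ'].
- by move=> qZ qW; apply: rpredD => //; apply: rpredZ.
- exact: mem0v.
- exact: alg.
- apply/eqP; rewrite -memv0 -cap memv_cap mem_cplx_conjv.
  by apply/andP.
Qed.

Lemma orbit_class_orb q q' : orb (subset_of q) (subset_of q') -> orbit_class q = orbit_class q'.
Proof. by move=> h; apply/orbit_classP. Qed.

Lemma orbit_class_conj q q' (m : set gC) : conjq (subset_of q) m -> conjq (subset_of q') m ->
  orbit_class q = orbit_class q'.
Proof.
move=> h h'; apply: orbit_class_orb.
by apply: orb_trans (conj_orb h) _; apply: orb_sym; exact: conj_orb.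
Qed.

Lemma open_QSpace (S : set (QSpace R)) :
  (forall q0, S q0 -> exists P, [/\ open_condition P, P (subset_of q0) &
     forall q, P (subset_of q) -> S q]) -> open S.
Proof.
move=> h; rewrite openE => q0 /h[P [oP Pq0 PS]].
rewrite /interior nbhsE; exists [set q | P (subset_of q)]; last exact: PS.
by split => //; exists [set q : grassmannian 3 gC | P [set` \val q]].
Qed.

Lemma open_orbit_space U : open U <-> open [set q | U (orbit_class q)].
Proof. by []. Qed.

Lemma disk_ball (A : set (disk R)) l : open A -> A l ->
  exists2 e : C, 0 < e & forall k : disk R, `|set_val l - set_val k| < e -> A k.
Proof.
move=> [O oO <-] /= Ol; have /nbhs_ballP[e e0 be] : nbhs (set_val l) O by exact: open_nbhs_nbhs.
by exists e => // k lk; apply: be.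
Qed.

(** Around each complex structure an open condition is chosen according to its type. By the
    classification and stability, its consequences are read off on the models. *)
Lemma open_class U :
  open [set l : disk R | U (orbit_class (II l))] ->
  (U (orbit_class (II disk0)) -> U (orbit_class III)) -> open U.
Proof.
move=> oU U0; apply/open_orbit_space/open_QSpace => q0 /= Uq0.
have II_class q l : conjq (subset_of q) (modelII (set_val l)) -> orbit_class q = orbit_class (II l).
  by move=> h; apply: (orbit_class_conj h); rewrite subset_of_II; exact: conj_refl.
have III_class q : conjq (subset_of q) modelIII -> orbit_class q = orbit_class III.
  by move=> h; apply: (orbit_class_conj h); rewrite subset_of_III; exact: conj_refl.
have of_disk x : disk R x -> exists l : disk R, set_val l = x.
  by move=> x1; exists (exist _ x (mem_set x1)).
case: (has_model_subset q0) => [h0|[x0 /of_disk[l0 <-] h0]|h0].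
- exists (@condI R); split; first exact: open_condI.
    by apply/(conj_stableP (@stable_condI R) h0); exact: condI_modelI.
  move=> q cq; case: (has_model_subset q) => [h|[l l1 h]|h].
  + by rewrite /= (orbit_class_conj h h0).
  + by move/(conj_stableP (@stable_condI R) h)/condI_modelII: cq.
  + by move/(conj_stableP (@stable_condI R) h)/condI_modelIII: cq.
- have Ul0 : U (orbit_class (II l0)) by rewrite -(II_class _ _ h0).
  have [e e0 be] := disk_ball oU Ul0.
  have [m0|m0] := eqVneq (set_val l0) 0.
    have l0E : l0 = disk0 by exact: val_inj.
    (* [cond_proj] rules out I and [cond_ratio] forces |l| < e on II_l. Type III remains possible,
       and there [U0] enters. *)
    exists (fun q : set gC => cond_ratio (e ^+ 2) q /\ cond_proj q); split.
    + apply: open_condition_and; [exact: open_cond_ratio|exact: open_cond_proj].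
    + rewrite m0 in h0; split.
        apply/(conj_stableP (@stable_cond_ratio R _) h0); apply: cond_ratio_model0.
        by rewrite exprn_gt0.
      by apply/(conj_stableP (@stable_cond_proj R) h0); exact: cond_proj_modelII.
    move=> q [cq pq] /=; case: (has_model_subset q) => [h|[x x1 h]|h].
    + by move/(conj_stableP (@stable_cond_proj R) h)/cond_proj_modelI: pq.
    + move/(conj_stableP (@stable_cond_ratio R _) h): cq => /(cond_ratio_modelII e0 x1).
      have [l lx] := of_disk _ x1; rewrite -lx in h * => le.
      by rewrite (II_class _ _ h); apply: be; rewrite m0 sub0r normrN.
    + by rewrite (III_class _ h); apply: U0; rewrite -l0E.
  have m1 : `|set_val l0| < 1 by exact: set_valP l0.
  (* The bound by e keeps l in the given ball; the other bound is what [cond_param_modelII]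
     requires. *)
  have [a [a0 ae am]] : exists a : C, [/\ 0 < a, a <= e & a <= 1 - `|set_val l0|].
    have d0 : 0 < 1 - `|set_val l0| by rewrite subr_gt0.
    have [le|le] := real_leP (gtr0_real e0) (gtr0_real d0); first by exists e.
    by exists (1 - `|set_val l0|); split=> //; exact: ltW.
  exists (cond_param (set_val l0) a); split; first exact: open_cond_param.
    by apply/(conj_stableP (@stable_cond_param R _ _) h0); exact: cond_param_self.
  move=> q cq /=; case: (has_model_subset q) => [h|[x x1 h]|h].
  + by move/(conj_stableP (@stable_cond_param R _ _) h)/cond_param_modelI: cq.
  + move/(conj_stableP (@stable_cond_param R _ _) h): cq => /(cond_param_modelII x1 a0 am).
    have [l lx] := of_disk _ x1; rewrite -lx in h * => le.
    by rewrite (II_class _ _ h); apply: be; exact: lt_le_trans ae.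
  + by move/(conj_stableP (@stable_cond_param R _ _) h)/cond_param_modelIII: cq.
- exists (@condIII R); split; first exact: open_condIII.
    by apply/(conj_stableP (@stable_condIII R) h0); exact: condIII_modelIII.
  move=> q cq; case: (has_model_subset q) => [h|[l l1 h]|h] /=.
  + by move/(conj_stableP (@stable_condIII R) h)/condIII_modelI: cq.
  + by move/(conj_stableP (@stable_condIII R) h)/condIII_modelII: cq => /(_ l1).
  + by rewrite (orbit_class_conj h h0).
Qed.

End Quotient.

(** * Continuous families of complex structures *)

Section Curves.
Variable R : realType.
Notation C := R[i].
Notation g := (sl2 R).
Notation gC := (sl2_cplx R).
Implicit Types (T : topologicalType).

Lemma continuous_linear T (f : gC -> C) (Z : T -> gC) :
  (forall a Z W, f (a *: Z + W) = a * f Z + f W) -> continuous_gC Z ->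
  continuous (fun t => f (Z t)).
Proof.
move=> fl [[h1 e1 f1] [h2 e2 f2]].
have f0 : f 0 = 0 by have := fl (-1) 0 0; rewrite scaler0 addr0 mulN1r addNr.
have fE X : f X = cH X.1 * f (slH R, 0) + (cE X.1 * f (slE R, 0) + (cF X.1 * f (slF R, 0) +
    (cH X.2 * f (0, slH R) + (cE X.2 * f (0, slE R) + cF X.2 * f (0, slF R))))).
  rewrite -[cF X.2 * _]addr0 -f0 -!fl; congr f.
  by apply: gCP; apply: sl2P; coord; ring.
have k c := @continuous_const R T c.
rewrite (_ : (fun t => f (Z t)) = fun t => cH (Z t).1 * f (slH R, 0) +
    (cE (Z t).1 * f (slE R, 0) + (cF (Z t).1 * f (slF R, 0) +
    (cH (Z t).2 * f (0, slH R) + (cE (Z t).2 * f (0, slE R) +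
    cF (Z t).2 * f (0, slF R)))))); last first.
  by apply/funext => t; rewrite fE.
exact: continuous_add (continuous_mul h1 (k _)) (continuous_add (continuous_mul e1 (k _))
  (continuous_add (continuous_mul f1 (k _)) (continuous_add (continuous_mul h2 (k _))
  (continuous_add (continuous_mul e2 (k _)) (continuous_mul f2 (k _)))))).
Qed.

Lemma continuous_mx T m n (M : T -> 'M[C]_(m, n)) :
  (forall i j, continuous (fun t => M t i j)) -> continuous M.
Proof.
move=> cM t; apply/cvg_ballP => e e0.
have h : \forall s \near t, forall i j, ball (M t i j) e (M s i j).
  apply: filter_forall => i; apply: filter_forall => j.
  by move/cvg_ballP : (cM i j t) => /(_ e e0).
by apply: filterS h => s hs; split.
Qed.

(** The spanning vectors lift the family to frames, where continuity is checked entrywise. *)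
Lemma open_curve T (Z : 'I_3 -> T -> gC) (q : T -> QSpace R) (V : set (QSpace R)) :
  (forall i, continuous_gC (Z i)) ->
  (forall t, subspace_of (q t) = <<[tuple Z i t | i < 3]>>%VS) ->
  open V -> open [set t | V (q t)].
Proof.
move=> cZ qZ [O oO <-].
(* Openness of O means that its preimage among frames is the trace of an open set O' of matrices. *)
have [O' oO' O'E] : open (@span_frame R 3 gC @^-1` O) by [].
pose M t : 'M[C]_(3, dim gC) := \matrix_(i < 3) v2r (Z i t).
have Mfree t : row_free (M t).
  apply: inj_row_free => v vM0.
  have fZ : free [tuple Z i t | i < 3].
    by rewrite /free -qZ size_tuple; exact: (valP (set_val (q t))).
  apply/rowP => i; rewrite mxE; move/freeP: fZ => /(_ (fun j => v 0 j)); apply.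
  transitivity (r2v (v *m M t) : gC); last by rewrite vM0 linear0.
  rewrite mulmx_sum_row linear_sum; apply: eq_bigr => j _.
  by rewrite linearZ (nth_map j) ?nth_ord_enum ?size_enum_ord //= rowK v2rK.
pose A t : frame 3 gC := exist _ (M t) (mem_set (Mfree t)).
have AE t : span_frame (A t) = set_val (q t).
  apply: val_inj; rewrite [RHS](qZ t) [LHS](_ : _ = <<frame_vectors (A t)>>%VS) //.
  have -> // : frame_vectors (A t) = [tuple Z i t | i < 3].
  by apply: eq_from_tnth => i; rewrite !tnth_mktuple rowK v2rK.
rewrite (_ : [set _ | _] = M @^-1` O').
  apply: open_comp oO' => t _; apply: continuous_mx => i j.
  rewrite (_ : (fun t => M t i j) = fun t => v2r (Z i t) 0 j); last by apply/funext => s; rewrite mxE.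
  by apply: (@continuous_linear _ (fun X => v2r X 0 j)) => // a X Y; rewrite linearP !mxE.
apply/seteqP; split=> t /=.
  by rewrite -AE => h; change ((set_val @^-1` O') (A t)); rewrite O'E.
by move=> h; rewrite -AE; change ((@span_frame R 3 gC @^-1` O) (A t)); rewrite -O'E.
Qed.

Lemma open_curve_tuple T (b : T -> 3.-tuple gC) (q : T -> QSpace R) (V : set (QSpace R)) :
  (forall i, continuous_gC (fun t => tnth (b t) i)) ->
  (forall t, subspace_of (q t) = <<b t>>%VS) -> open V -> open [set t | V (q t)].
Proof.
move=> cb qb; apply: (open_curve (Z := fun i t => tnth (b t) i)) => // t.
have E : b t = [tuple tnth (b t) i | i < 3].
  by apply: eq_from_tnth => i; rewrite tnth_mktuple.
by rewrite qb {1}E.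
Qed.

Lemma continuous_sl2_scale T (f : T -> C) (X Y : g) : continuous f ->
  continuous_sl2 (fun t => f t *: X + Y).
Proof.
move=> cf; have k c := @continuous_const R T c.
split; [under eq_fun do rewrite !sl2_coordD !sl2_coordZ|
  under eq_fun do rewrite !sl2_coordD !sl2_coordZ|
  under eq_fun do rewrite !sl2_coordD !sl2_coordZ];
  exact: continuous_add (continuous_mul cf (k _)) (k _).
Qed.

Lemma continuous_gC_pair T (F G : T -> g) : continuous_sl2 F -> continuous_sl2 G ->
  continuous_gC (fun t => (F t, G t) : gC).
Proof. exact: conj. Qed.

Lemma open_II (V : set (QSpace R)) : open V -> open [set l : disk R | V (II l)].
Proof.
apply: (open_curve_tuple (b := fun l : disk R => II_basis (set_val l))) => // i.
have k X := @continuous_sl2_cst R (disk R) X.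
case: i => [[|[|[|//]]] p].
- apply: (continuous_gC_pair (k (slH R))).
  have := @continuous_sl2_scale _ (fun l : disk R => set_val l) (slH R) 0 (@initial_continuous _ _ _).
  by under eq_fun do rewrite addr0.
- exact: (continuous_gC_pair (k (slE R)) (k 0)).
- exact: (continuous_gC_pair (k 0) (k (slF R))).
Qed.

(* A curve in the orbit of III whose value at t = 0 is II with parameter 0. *)
Definition III_curve_basis (t : C) : 3.-tuple gC :=
  [tuple (slH R, 0); (slE R, 0); (0, t *: slH R + slF R)].

Lemma III_curve_complement (t : C) :
  (<<III_curve_basis t>> + cplx_conjv <<III_curve_basis t>>)%VS = fullv.
Proof.
have m1 j (j3 : (j < 3)%N) :=
  memv_addl_span (mem_nth (0, 0) (j3 : (j < size (III_curve_basis t))%N)).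
have m2 j (j3 : (j < 3)%N) :=
  memv_addr_span (mem_nth (0, 0) (j3 : (j < size (III_curve_basis t))%N)).
have h1 := m1 0%N isT; have e1 := m1 1%N isT; have f2 := m1 2%N isT.
have h2 := m2 0%N isT; have e2 := m2 1%N isT; have f1 := m2 2%N isT.
rewrite /cplx_conj /= ?conj_sl20 ?conj_sl2D ?conj_sl2_scale ?conj_slH ?conj_slE ?conj_slF
  in h1 h2 e1 e2 f1 f2.
apply: sl2_cplx_gen => //.
- rewrite (_ : (slF R, 0) = (conjc t *: slH R + slF R, 0) - conjc t *: (slH R, 0)).
    by rewrite rpredB // rpredZ.
  by apply: gCP; apply: sl2P; coord; ring.
- rewrite (_ : (0, slF R) = (0, t *: slH R + slF R) - t *: (0, slH R)).
    by rewrite rpredB // rpredZ.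
  by apply: gCP; apply: sl2P; coord; ring.
Qed.

Lemma III_curve_subalgebra (t : C) : {in III_curve_basis t &,
  forall Z W, cplx_bracket Z W \in <<III_curve_basis t>>%VS}.
Proof.
have m j (j3 : (j < 3)%N) := memv_span (mem_nth (0, 0) (j3 : (j < size (III_curve_basis t))%N)).
have e1 := m 1%N isT; rewrite /= in e1.
apply: three_subalgebra.
- rewrite (_ : cplx_bracket _ _ = 2 *: (slE R, 0)) ?rpredZ //.
  by congr (_, _); rewrite /= ?bracketX0 ?scaler0 // bracketHE.
- by rewrite (_ : cplx_bracket _ _ = 0) ?mem0v // /cplx_bracket /= bracketX0 bracket0X.
- by rewrite (_ : cplx_bracket _ _ = 0) ?mem0v // /cplx_bracket /= bracketX0 bracket0X.
Qed.

Definition III_curve (t : C) : QSpace R :=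
  exist (fun q => q \in complex_structures R) _
    (mem_set (span_complex_structure (III_curve_complement t) (@III_curve_subalgebra t))).

Lemma subset_of_III_curve t :
  subset_of (III_curve t) = glued (slE R) (slH R) 0 (t *: slH R + slF R).
Proof.
transitivity ([set` <<III_curve_basis t>>%VS]); first by [].
rewrite span_lin3; apply: lin3_eq; [exact: lin3_2|exact: lin3_1|exact: lin3_3|
  exact: lin3_2|exact: lin3_1|exact: lin3_3].
Qed.

Lemma open_III_curve (V : set (QSpace R)) : open V -> open [set t | V (III_curve t)].
Proof.
apply: (open_curve_tuple (b := III_curve_basis)) => // i.
have k X := @continuous_sl2_cst R C X.
case: i => [[|[|[|//]]] p].
- exact: (continuous_gC_pair (k (slH R)) (k 0)).
- exact: (continuous_gC_pair (k (slE R)) (k 0)).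
- apply: (continuous_gC_pair (k 0)); apply: continuous_sl2_scale.
  by move=> t; exact: cvg_id.
Qed.

(** At t = 0 the curve is in the class of II_0, so V also contains its class at some small t <> 0,
    which is that of III. *)
Lemma III_in_closure (V : set (orbit_space R)) : open V ->
  V (orbit_class (II disk0)) -> V (orbit_class III).
Proof.
move=> /open_orbit_space/open_III_curve oV V0.
have c0 : [set t | V (orbit_class (III_curve t))] 0.
  rewrite /= (_ : orbit_class (III_curve 0) = orbit_class (II disk0)) //.
  apply: orbit_class_orb; rewrite subset_of_III_curve subset_of_II modelII_glued.
  by rewrite !scale0r add0r; exact: orb_refl.
have /nbhs_ballP[e e0 be] := open_nbhs_nbhs (conj oV c0).
have e2 : e / 2 != 0 by rewrite gt_eqF // divr_gt0 // ltr0n.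
have := be (e / 2); rewrite /ball /= sub0r normrN gtr0_norm ?divr_gt0 ?ltr0n //.
rewrite ltr_pdivrMr ?ltr0n // ltr_pMr // ltr1n => /(_ isT).
rewrite (_ : orbit_class (III_curve _) = orbit_class III) //.
apply: (orbit_class_conj (m := modelIII)).
  by rewrite subset_of_III_curve; exact: glued_conj_III.
by rewrite subset_of_III; exact: conj_refl.
Qed.

End Curves.

Theorem theorem5p1 (R : realType) (U : set (orbit_space R)) :
  open U <->
  open [set l : disk R | U (orbit_class (II l))] /\
  (U (orbit_class (II disk0)) -> U (orbit_class III)).
Proof.
split=> [oU|[oII U0]]; last exact: open_class.
split; last exact: III_in_closure.
by apply: (@open_II _ [set q | U (orbit_class q)]); apply/open_orbit_space.
Qed.
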